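(* Let $0<\sigma<1$, $1<p,q<\infty$, $0\leq\beta,\mu<1$, $1/p-1/q=\sigma$, $\omega\in A_{(p,q)}^+$ and $q+\mu\leq2$. Suppose the operator $F$ defined by $F(u)(t)=f(t,u(t))$ is bounded and continuous from $L^{q,\mu}_+((0,\delta),\omega^q)$ to $L^{p,\beta}_+((0,\delta),\omega^p)$. If $\frac{1}{2}\big(1+\frac{1}{p}\big)<\alpha<1$, then the Cauchy problem $$\begin{cases}D_{0^{+}}^{\alpha}u(t)=f(t,u(t)),\\ I_{0^{+}}^{1-\alpha}u(0)=0\end{cases}$$ has at least one solution $u\in L^{q,\mu}_+((0,\delta),\omega^q)$ for a sufficiently small $\delta>0$. Furthermore, if there exists a constant $C_F>0$ such that $$\|Fu-Fv\|_{L^{p,\beta}_+((0,\delta),\omega^p)}\leq C_F\|u-v\|_{L^{q,\mu}_+((0,\delta),\omega^q)},\quad u,v\in L^{q,\mu}_+((0,\delta),\omega^q),$$ then the solution of the Cauchy problem is unique in $L^{q,\mu}_+((0,\delta),\omega^q)$ for a sufficiently small $\delta>0$.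
   Context: A weight $\omega$ is a positive function on $\mathbb{R}$; $p'$ is the conjugate exponent of $p$. Riemann-Liouville integral and derivative of order $\alpha\in(0,1)$: $I_{0^+}^{\alpha}g(t)=\frac{1}{\Gamma(\alpha)}\int_{0}^{t}\frac{g(\tau)}{(t-\tau)^{1-\alpha}}\,d\tau$ and $D_{0^+}^{\alpha}g(t)=\frac{d}{dt}I_{0^+}^{1-\alpha}g(t)$, for $0<t<\delta$. Weight class: for $1<p<q$ and $1/p-1/q=\sigma\in(0,1)$, $\omega\in A^+_{(p,q)}$ means that there is a constant $C$ with $$\frac{1}{(c-a)^{1-\sigma}}\Big(\int_a^b\omega^q\Big)^{1/q}\Big(\int_b^c\omega^{-p'}\Big)^{1/p'}<C\quad\text{for all } a<b<c\text{ in }\mathbb{R}.$$ Local one-sided weighted Morrey space on $(0,\delta)$, $\delta>0$: for $1\le p<\infty$, $0\le\lambda<1$, $1\le\theta<\infty$, put $\Phi_{\omega,\lambda,\theta}^{+}(x_0,h)=h^{\lambda-1}\int_{x_0-h}^{x_0}\omega(x)^\theta\,dx$. Then $L^{p,\lambda}_+((0,\delta),\omega^\theta)$ consists of the functions $g$ on $(0,\delta)$ with $$\|g\|_{L^{p,\lambda}_{+}((0,\delta),\omega^\theta)}=\sup_{0\leq x_0\leq \delta,\ 0<h\leq \delta}\Big(\frac{1}{\Phi_{\omega,\lambda,\theta}^{+}(x_0,h)}\int_{(x_0,x_0+h)\cap(0,\delta)}|g(y)|^p\,dy\Big)^{1/p}<\infty.$$ Thus $L^{p,\beta}_+((0,\delta),\omega^p)$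 uses $\Phi^+_{\omega,\beta,p}$, and $L^{q,\mu}_+((0,\delta),\omega^q)$ uses $\Phi^+_{\omega,\mu,q}$ with integrability exponent $q$. *)

(* Defs.v *)
From HB Require Import structures.
From mathcomp Require Import all_boot all_order all_algebra.
From mathcomp Require Import all_classical all_reals all_analysis.
Set Implicit Arguments.
Unset Strict Implicit.
Unset Printing Implicit Defensive.
Import Order.TTheory GRing.Theory Num.Theory.
Import numFieldNormedType.Exports.
Local Open Scope classical_set_scope.
Local Open Scope ring_scope.

Notation leb := (@lebesgue_measure _).

(* Lebesgue measurability: [lebesgue_measure] lives on the Borel sigma-algebra,
   so we ask for a Borel representative modulo null sets.  For such functions
   the library integral (a supremum over simple functions below the positive
   and negative parts) has the same value as for the representative. *)
Definition lmeasurable (R : realType) (D : set R) (g : R -> R) : Prop :=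
  exists2 h : R -> R, measurable_fun D h & ae_eq leb D g h.

Definition weight (R : realType) (w : R -> R) : Prop :=
  (forall x, 0 < w x) /\ lmeasurable setT w.

Definition conj_exponent (R : realType) (p : R) : R := p / (p - 1).

(* The integrals of a weight over nonempty open intervals are positive (possibly
   infinite), so the extended-real products below are never [0 * +oo]. *)
Definition Aplus (R : realType) (p q sigma : R) (w : R -> R) : Prop :=
  weight w /\
  exists C : R, forall a b c : R, a < b -> b < c ->
    ((((c - a) `^ (1 - sigma))^-1)%R%:E
     * (\int[leb]_(x in `]a, b[) (w x `^ q)%R%:E) `^ (q^-1)%R
     * (\int[leb]_(x in `]b, c[) (w x `^ (- conj_exponent p))%R%:E)
         `^ ((conj_exponent p)^-1)%R < C%:E)%E.

Definition morrey_Phi (R : realType) (w : R -> R) (lambda theta x0 h : R)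
    : \bar R :=
  ((h `^ (lambda - 1))%R%:E
   * \int[leb]_(x in `](x0 - h)%R, x0[) (w x `^ theta)%R%:E)%E.

(* Functions on (0, delta) are represented by total functions; their values
   outside (0, delta) are irrelevant.  The inverse is that of [\bar R]. *)
Definition morrey_norm (R : realType) (delta p lambda theta : R) (w g : R -> R)
    : \bar R :=
  ereal_sup [set N | exists x0 h : R,
    [/\ 0 <= x0 <= delta, 0 < h <= delta &
     N = (((morrey_Phi w lambda theta x0 h)^-1
           * \int[leb]_(y in `]x0, (x0 + h)%R[ `&` `]0%R, delta[)
               (`|g y| `^ p)%R%:E) `^ (p^-1)%R)%E]].

Definition morrey (R : realType) (delta p lambda theta : R) (w : R -> R)
    : set (R -> R) :=
  [set g | lmeasurable `]0, delta[ g /\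
           (morrey_norm delta p lambda theta w g < +oo)%E].

(* [F] is not linear: bounded means that bounded sets have bounded images. *)
Definition bounded_operator (R : realType) (X : set (R -> R))
    (NX NY : (R -> R) -> \bar R) (F : (R -> R) -> R -> R) : Prop :=
  forall r : R, exists M : R, forall u, X u ->
    (NX u <= r%:E)%E -> (NY (F u) <= M%:E)%E.

Definition continuous_operator (R : realType) (X : set (R -> R))
    (NX NY : (R -> R) -> \bar R) (F : (R -> R) -> R -> R) : Prop :=
  forall u, X u -> forall e : R, 0 < e -> exists2 d : R, 0 < d &
    forall v, X v -> (NX (v \- u)%R < d%:E)%E -> (NY (F v \- F u)%R < e%:E)%E.

Definition lipschitz_operator (R : realType) (X : set (R -> R))
    (NX NY : (R -> R) -> \bar R) (F : (R -> R) -> R -> R) (C : R) : Prop :=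
  forall u v, X u -> X v -> (NY (F u \- F v)%R <= C%:E * NX (u \- v)%R)%E.

Definition nemytskii (R : realType) (f : R -> R -> R) (u : R -> R) : R -> R :=
  fun t => f t (u t).

Definition Gamma (R : realType) (z : R) : R :=
  \int[leb]_(x in `]0, +oo[) (x `^ (z - 1) * expR (- x)).

Definition RL_integral (R : realType) (alpha : R) (g : R -> R) (t : R) : R :=
  (Gamma alpha)^-1 * \int[leb]_(s in `]0, t[) (g s / (t - s) `^ (1 - alpha)).

Definition RL_derivative (R : realType) (alpha : R) (g : R -> R) : R -> R :=
  derive1 (RL_integral (1 - alpha) g).

Definition absolutely_continuous (R : realType) (D : set R) (g : R -> R)
    : Prop :=
  forall e : R, 0 < e -> exists2 d : R, 0 < d &
    forall (n : nat) (a b : 'I_n -> R),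
      (forall i, [/\ D (a i), D (b i) & a i < b i]) ->
      trivIset setT (fun i => `]a i, b i[%classic) ->
      \sum_(i < n) (b i - a i) < d ->
      \sum_(i < n) `|g (b i) - g (a i)| < e.

(* The right-hand side is only an element of a Lebesgue-type space, so the
   equation is understood in the usual sense for Riemann-Liouville derivatives
   of integrable functions: I^(1-alpha) u is absolutely continuous and the
   equation holds almost everywhere.  Without absolute continuity, Cantor-type
   functions would solve the homogeneous problem.  The initial condition is a
   limit at 0+, since the integral over an empty interval is 0 for every u. *)
Definition cauchy_solution (R : realType) (alpha delta : R) (f : R -> R -> R)
    (u : R -> R) : Prop :=
  [/\ absolutely_continuous `]0, delta[ (RL_integral (1 - alpha) u),
      {ae leb, forall t, t \in `]0, delta[ ->
         derivable (RL_integral (1 - alpha) u) t 1 /\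
         RL_derivative alpha u t = f t (u t)} &
      RL_integral (1 - alpha) u t @[t --> 0^'+] --> (0 : R)].

(* Main.v *)
Require Import Defs.
From HB Require Import structures.
From mathcomp Require Import all_boot all_order all_algebra.
From mathcomp Require Import ring lra.
From mathcomp Require Import all_classical all_reals all_analysis.
From mathcomp Require Import measurable_realfun.
Import Order.TTheory GRing.Theory Num.Theory.
Import numFieldNormedType.Exports.
Local Open Scope classical_set_scope.
Local Open Scope ring_scope.

(** The Cauchy problem is equivalent to the integral equation
    [u = RL_integral alpha (F u)] on [(0, d)], and this equation is solved among
    bounded functions rather than in the Morrey space itself.

    The passage between the two problems rests on Euler's identity for the Beta
    integral of complementary exponents, by which fractional integrals of orders
    [alpha] and [1 - alpha] compose to the ordinary integral
    ([RL_integral_compl]). From the integral equation one gets the differential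
    equation by Lebesgue's differentiation theorem ([fixed_cauchy_solution]). For
    the converse ([cauchy_solution_fixed]) one needs that an absolutely
    continuous function whose derivative vanishes almost everywhere is constant
    ([absolutely_continuous_derive0]).

    Two embeddings make bounded functions sufficient. The space [Y] is contained
    in [L^p] of the interval, and [alpha > 1 / p], so that by Hoelder's inequality
    the fractional integral maps [Y] to Hoelder continuous functions vanishing at
    zero, with small uniform norm on short intervals ([RL_morrey_holder]).
    Conversely, the weight condition makes [w `^ q] and [w `^ (- p')] locally
    integrable; Hoelder's inequality for [1 = w * w^-1] and [q + mu <= 2] then
    show that bounded functions belong to [X], with norm at most a constant times
    the uniform norm ([bounded_in_X]).

    Existence: on a short interval the integral operator maps the unit ball of the
    uniform norm to an equicontinuous family inside this ball, and it is
    continuous for uniform convergence. As the value of [RL_integral alpha (F u)]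
    at [t] depends only on [u] before [t], the equation with a delay can be solved
    step by step, and a uniform limit of solutions for delays tending to zero is a
    solution ([volterra_fixed_point]).

    Uniqueness: a solution in [X], extended by zero to the reference interval, is
    still in the Morrey space ([morrey_cut_itv]), hence it is almost everywhere
    equal to a bounded solution of the integral equation
    ([solution_bounded_fixed]); under the Lipschitz condition the integral
    operator is a contraction of the uniform norm on a short interval
    ([bounded_fixed_unique]). *)

(** * Integrals of functions equal almost everywhere *)

Section integral_congr_ae.
Import HBNNSimple.

(** Cutting a simple function on a null set does not change its integral, so
    the suprema over simple functions that define the integrals of two arbitrary
    functions agree as soon as these are equal almost everywhere. *)
Lemma integral_congr_ae d (T : measurableType d) (R : realType)
    (mu : {measure set T -> \bar R}) (D : set T) (f g : T -> \bar R) :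
  ae_eq mu D f g ->
  (\int[mu]_(x in D) f x = \int[mu]_(x in D) g x)%E.
Proof.
move=> [N [mN N0 fgN]].
have {}fgN x : ~ N x -> (f \_ D) x = (g \_ D) x.
  move=> Nx; rewrite /patch; case: ifPn => // /set_mem Dx.
  by apply: contrapT => h; apply: Nx; apply: fgN => /(_ Dx).
have le_sup (F G : T -> \bar R) : (forall x, 0 <= G x)%E ->
    (forall x, ~ N x -> F x = G x) ->
    (ereal_sup [set sintegral mu h |
        h in [set h : {nnsfun T >-> R} | forall x, (h x)%:E <= F x]] <=
     ereal_sup [set sintegral mu h |
        h in [set h : {nnsfun T >-> R} | forall x, (h x)%:E <= G x]])%E.
  move=> G0 FG; apply: ge_ereal_sup => _ [h /= hF <-].
  pose h' : {nnsfun T >-> R} := proj_nnsfun h (measurableC mN).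
  have h'E x : h' x = h x * \1_(~` N) x by [].
  apply: ereal_sup_ubound; exists h'.
    move=> x; rewrite -/(h' x) h'E indicE; have [Nx|Nx] := pselect (N x).
      by rewrite memNset ?mulr0//; apply.
    by rewrite mem_set// mulr1 -FG.
  rewrite -!integralT_nnsfun; apply: ge0_ae_eq_integral => //.
  - exact/measurable_EFinP.
  - exact/measurable_EFinP.
  - by move=> x _; rewrite lee_fin.
  - by move=> x _; rewrite lee_fin.
  - exists N; split => // x; apply: contra_notP => Nx _.
    by rewrite h'E indicE mem_set// mulr1.
have eq_sup (F G : T -> \bar R) : (forall x, 0 <= F x)%E ->
    (forall x, 0 <= G x)%E -> (forall x, ~ N x -> F x = G x) ->
    (ereal_sup [set sintegral mu h |
        h in [set h : {nnsfun T >-> R} | forall x, (h x)%:E <= F x]] =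
     ereal_sup [set sintegral mu h |
        h in [set h : {nnsfun T >-> R} | forall x, (h x)%:E <= G x]])%E.
  move=> F0 G0 FG; apply/eqP; rewrite eq_le !le_sup// => x Nx.
  by rewrite FG.
rewrite /integral; congr (_ - _)%E; apply: eq_sup => // x Nx.
  by rewrite !funeposE fgN.
by rewrite !funenegE fgN.
Qed.

End integral_congr_ae.

(** * Affine changes of variables *)

Section affine.
Context {R : realType}.
Local Notation mu := (@lebesgue_measure R).

(** The image of the Lebesgue measure under [x |-> r * x + d], multiplied by
    [`|r|], gives intervals their length, hence is the Lebesgue measure. *)
Lemma ge0_integral_affine (f : R -> \bar R) (r d : R) : r != 0 ->
  measurable_fun setT f -> (forall x, 0 <= f x)%E ->
  (\int[mu]_x f x = `|r|%:E * \int[mu]_x f (r * x + d)%R)%E.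
Proof.
move=> r0 mf f0.
pose phi : measurableTypeR R -> measurableTypeR R := fun x => r * x + d.
have mphi : measurable_fun setT phi.
  by apply: measurable_funD => //; exact: measurable_funM.
have [nu nuE] : exists nu : {measure set (measurableTypeR R) -> \bar R},
    nu = pushforward mu phi :> (set (measurableTypeR R) -> \bar R).
  unshelve refine (ex_intro _ _ erefl); exact: mphi.
pose nr := NngNum (normr_ge0 r).
have scaled (A : set R) : measurable A ->
    mu A = mscale nr nu A.
  move=> mA; apply: lebesgue_measure_unique => //= _ [[a b] _] <-.
  rewrite /mscale /= nuE /pushforward.
  have [ab|ab] := ltP a b; last first.
    rewrite set_itv_ge ?bnd_simp -?leNgt//.
    by rewrite preimage_set0 !measure0 mule0.
  have [r_gt0|r_lt0|/eqP] := ltgtP 0 r; last by rewrite eq_sym (negbTE r0).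
  - have -> : phi @^-1` `]a, b] = `](a - d) / r, (b - d) / r]%classic.
      apply/seteqP; split=> x /=; rewrite !in_itv/= /phi.
        by rewrite ltr_pdivrMr// ler_pdivlMr// ltrBlDr lerBrDr (mulrC x).
      by rewrite ltr_pdivrMr// ler_pdivlMr// ltrBlDr lerBrDr (mulrC x).
    rewrite !lebesgue_measure_itv/= !lte_fin ab ltr_pM2r ?invr_gt0//.
    rewrite ltrD2r ab -!EFinD -EFinM gtr0_norm//; congr EFin.
    by field; rewrite gt_eqF.
  - have -> : phi @^-1` `]a, b] = `[(b - d) / r, (a - d) / r[%classic.
      apply/seteqP; split=> x /=; rewrite !in_itv/= /phi => /andP[h1 h2].
        by rewrite ler_ndivrMr// ltr_ndivlMr// (mulrC x) ltrBlDr lerBrDr h1 h2.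
      move: h1 h2; rewrite ler_ndivrMr// ltr_ndivlMr// (mulrC x) ltrBlDr lerBrDr.
      by move=> -> ->.
    rewrite !lebesgue_measure_itv/= !lte_fin ab ltr_nM2r ?invr_lt0//.
    rewrite ltrD2r ab -!EFinD -EFinM ltr0_norm//; congr EFin.
    by field; rewrite lt_eqF.
have -> : (\int[mu]_x f x = \int[mscale nr nu]_x f x)%E.
  by apply: eq_measure_integral => A mA _; exact: scaled.
rewrite ge0_integral_mscale//=; congr (_ * _)%E.
by rewrite nuE ge0_integral_pushforward.
Qed.

End affine.

(** * The Riemann-Liouville kernel and Euler's integrals *)

Section kernel.
Context {R : realType}.
Local Notation mu := (@lebesgue_measure R).

(** The Riemann-Liouville kernel, extended by zero to the negative half-line: in
    this form fractional integrals are convolutions on the whole line, and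
    [powker 1] is the indicator function of the positive half-line. *)
Definition powker (a x : R) : R := if 0 < x then x `^ (a - 1) else 0.

Lemma powker_ge0 a x : 0 <= powker a x.
Proof. by rewrite /powker; case: ifP => // _; exact: powR_ge0. Qed.

Lemma powker_le0 a x : x <= 0 -> powker a x = 0.
Proof. by rewrite /powker ltNge => ->. Qed.

Lemma powker_gt0 a x : 0 < x -> powker a x = x `^ (a - 1).
Proof. by rewrite /powker => ->. Qed.

Lemma measurable_powker a : measurable_fun setT (powker a).
Proof.
by apply: measurable_fun_ifT => //; exact: measurable_fun_ltr.
Qed.

Lemma measurable_fun_powker d (T : measurableType d) a (f : T -> R) :
  measurable_fun setT f -> measurable_fun setT (powker a \o f).
Proof. by move=> mf; apply: measurableT_comp mf; exact: measurable_powker. Qed.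

(** On [[1 / n, 1]] the integral is given by the primitive [x `^ g / g], which
    is bounded by [1 / g] since [0 < g]. *)
Lemma integral_powR01_lty (g : R) : 0 < g ->
  (\int[mu]_(x in `]0%R, 1%R]) (x `^ (g - 1))%:E < +oo)%E.
Proof.
move=> g0.
pose F (n : nat) : set R := `[n.+1%:R^-1, 1]%classic.
have -> : (`]0, 1]%classic : set R) = \bigcup_n F n.
  apply/seteqP; split => x /=.
    rewrite in_itv/= => /andP[x0 x1].
    exists (Num.truncn x^-1) => //=; rewrite /F /= in_itv/= x1 andbT.
    by rewrite invf_ple ?posrE// ltW// truncnS_gt.
  move=> [n _]; rewrite /F /= !in_itv/= => /andP[nx ->].
  by rewrite andbT (lt_le_trans _ nx).
have mpow (A : set R) : measurable A ->
    measurable_fun A (fun x : R => (x `^ (g - 1))%:E).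
  move=> mA; apply/measurable_EFinP.
  by apply: measurable_funTS; exact: measurable_powR.
have h : ((\int[mu]_(x in F i) (x `^ (g - 1))%:E)%E @[i --> \oo] -->
   (\int[mu]_(x in \bigcup_i F i) (x `^ (g - 1))%:E)%E).
  apply: ge0_nondecreasing_set_cvg_integral.
  - move=> m n mn; apply/subsetPset => x; rewrite /F /= !in_itv/= => /andP[h ->].
    by rewrite andbT (le_trans _ h)// lef_pV2 ?posrE// ler_nat ltnS.
  - by move=> i; exact: measurable_itv.
  - by move=> i; apply: mpow; exact: measurable_itv.
  - by move=> i x _; rewrite lee_fin powR_ge0.
rewrite -(cvg_lim _ h)//.
apply: (@le_lt_trans _ _ (g^-1)%:E); last exact: ltry.
apply: lime_le; first by apply/cvg_ex; eexists; exact: h.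
near=> n.
have n1 : n.+1%:R^-1 < 1 :> R.
  by rewrite invf_lt1// ltr1n ltnS; near: n; exists 1%N.
have n0 : 0 < n.+1%:R^-1 :> R by [].
rewrite /F (@continuous_FTC2 _ _ (fun x => g^-1 * x `^ g)) //.
- rewrite -EFinD lee_fin powR1 mulr1 gerBl.
  by rewrite mulr_ge0 ?powR_ge0// invr_ge0 ltW.
- apply: derivable_within_continuous => x; rewrite in_itv/= => /andP[nx _].
  by apply: derivable_powR; rewrite in_itv/= andbT (lt_le_trans n0).
- have dF x : 0 < x -> derivable (fun x : R => g^-1 * x `^ g) x 1.
    move=> x0; apply: derivableM; first exact: derivable_cst.
    by apply: derivable_powR; rewrite in_itv/= andbT.
  have cF x : 0 < x -> {for x, continuous (fun x : R => g^-1 * x `^ g)}.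
    by move=> /dF/derivable1_diffP/differentiable_continuous.
  split.
  + by move=> x; rewrite in_itv/= => /andP[nx _]; apply: dF; exact: lt_trans nx.
  + by apply: cvg_at_right_filter; exact: cF.
  + by apply: cvg_at_left_filter; exact: cF.
- move=> x; rewrite in_itv/= => /andP[nx _].
  have x0 : 0 < x by exact: lt_trans nx.
  rewrite derive1Ml; last by apply: derivable_powR; rewrite in_itv/= andbT.
  rewrite powR_derive1 ?in_itv/= ?andbT//.
  by rewrite mulrA mulVf ?mul1r// gt_eqF.
Unshelve. all: by end_near. Qed.

End kernel.

Section gamma.
Context {R : realType}.
Local Notation mu := (@lebesgue_measure R).

Lemma powker1E (x : R) : powker 1 x = (0 < x)%R%:R.
Proof. by rewrite /powker subrr powRr0; case: ifP. Qed.

Lemma powkerM (a t x : R) : 0 < t -> powker a (t * x) = t `^ (a - 1) * powker a x.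
Proof.
move=> t0; rewrite /powker pmulr_rgt0//.
by case: ifP => x0; rewrite ?mulr0// powRM// ltW.
Qed.

Lemma measurable_powker_conv (a b t : R) :
  measurable_fun setT (fun x => (powker a x * powker b (t - x))%:E).
Proof.
apply/measurable_EFinP; apply: measurable_funM; first exact: measurable_powker.
by apply: measurable_fun_powker; apply: measurable_funB.
Qed.

(** Homogeneity of the convolution of two kernels: substitute [t * x] for [x]. *)
Lemma integral_powker_conv_scale (a b t : R) : 0 < t ->
  (\int[mu]_x (powker a x * powker b (t - x))%:E =
   (t `^ (a + b - 1))%:E * \int[mu]_x (powker a x * powker b (1 - x))%:E)%E.
Proof.
move=> t0; rewrite (@ge0_integral_affine _ _ t 0 (lt0r_neq0 t0)); last 2 first.
- exact: measurable_powker_conv.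
- by move=> x; rewrite lee_fin mulr_ge0 ?powker_ge0.
have kE x : (powker a (t * x + 0) * powker b (t - (t * x + 0)))%:E =
    ((t `^ (a - 1) * t `^ (b - 1))%:E * (powker a x * powker b (1 - x))%:E)%E.
  have -> : t - (t * x + 0) = t * (1 - x) by ring.
  rewrite addr0 -EFinM !powkerM//.
  by rewrite mulrACA.
under eq_integral do rewrite kE.
rewrite ge0_integralZl//; last 3 first.
- exact: measurable_powker_conv.
- by move=> x _; rewrite lee_fin mulr_ge0 ?powker_ge0.
- by rewrite lee_fin mulr_ge0 ?powR_ge0.
rewrite muleA -EFinM gtr0_norm// -powRD; last by rewrite (gt_eqF t0) implybT.
rewrite -[X in X * _]powRr1 ?ltW// -powRD; last by rewrite (gt_eqF t0) implybT.
by congr ((_ `^ _)%:E * _)%E; ring.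
Qed.

Lemma integral_powker_conv_sym (a b : R) :
  (\int[mu]_x (powker a x * powker b (1 - x))%:E =
   \int[mu]_x (powker b x * powker a (1 - x))%:E)%E.
Proof.
have N1 : (-1 : R) != 0 by rewrite oppr_eq0.
rewrite (@ge0_integral_affine _ _ (-1) 1 N1); last 2 first.
- exact: measurable_powker_conv.
- by move=> x; rewrite lee_fin mulr_ge0 ?powker_ge0.
rewrite normrN1 mul1e; apply: eq_integral => x _.
by rewrite mulN1r opprD opprK addrCA subrr addr0 mulrC addrC.
Qed.

Lemma integral_powker_lty (g : R) : 0 < g ->
  (\int[mu]_x (powker 1 x * powker g (1 - x))%:E < +oo)%E.
Proof.
move=> g0; rewrite integral_powker_conv_sym.
apply: le_lt_trans (integral_powR01_lty g g0).
rewrite [leRHS]integral_mkcond; apply: ge0_le_integral => //.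
- by move=> x _; rewrite lee_fin mulr_ge0 ?powker_ge0.
- exact: measurable_powker_conv.
- apply/(measurable_restrictT _ _).1 => //.
  by apply/measurable_EFinP; apply: measurable_funTS; exact: measurable_powR.
- move=> x _; rewrite patchE powker1E subr_gt0.
  case: ifPn => [|]; rewrite ?inE ?notin_setE /= in_itv/=.
    move=> /andP[x0 _]; rewrite lee_fin powker_gt0//.
    by case: (x < 1); rewrite ?mulr1// mulr0 powR_ge0.
  move=> /negP; rewrite negb_and -leNgt -ltNge => /orP[x0|x1].
    by rewrite powker_le0// mul0r.
  by rewrite ltNge (ltW x1) mulr0.
Qed.

(** The estimates below use only that the integral is a finite multiple of
    [t `^ g]; the factor is in fact [1 / g]. *)
Lemma integral_powker (g : R) : 0 < g -> exists2 c : R, 0 <= c &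
  forall t, 0 <= t ->
    (\int[mu]_x (powker 1 x * powker g (t - x))%:E = (c * t `^ g)%:E)%E.
Proof.
move=> g0; set c := (\int[mu]_x (powker 1 x * powker g (1 - x))%:E)%E.
have c0 : (0 <= c)%E.
  by apply: integral_ge0 => x _; rewrite lee_fin mulr_ge0 ?powker_ge0.
have cfin : c \is a fin_num by rewrite ge0_fin_numE// integral_powker_lty.
exists (fine c) => [|t]; first exact: fine_ge0.
rewrite le_eqVlt => /orP[/eqP<-|t0].
  rewrite powR0 ?gt_eqF// mulr0 integral0_eq// => x _.
  have [x0|x0] := leP x 0; first by rewrite powker_le0// mul0r.
  by rewrite (powker_le0 g) ?mulr0// sub0r oppr_le0 ltW.
rewrite integral_powker_conv_scale// -/c -[c in LHS]fineK// -EFinM mulrC.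
by congr (_ * _ `^ _)%:E; ring.
Qed.

Lemma measurable_gamma_integrand (a : R) :
  measurable_fun setT (fun x => (powker a x * expR (- x))%:E).
Proof.
apply/measurable_EFinP; apply: measurable_funM; first exact: measurable_powker.
by apply: measurableT_comp => //; exact: measurable_expR.
Qed.

Lemma gamma_integrand_ge0 (a x : R) : (0 <= (powker a x * expR (- x))%:E)%E.
Proof. by rewrite lee_fin mulr_ge0 ?powker_ge0 ?expR_ge0. Qed.

Lemma GammaE (a : R) :
  Gamma a = fine (\int[mu]_x (powker a x * expR (- x))%:E)%E.
Proof.
rewrite /Gamma /Rintegral integral_mkcond; congr fine.
apply: eq_integral => x _; rewrite patchE.
case: ifPn => [|]; rewrite ?inE ?notin_setE /= in_itv/= andbT.
  by move=> x0; rewrite powker_gt0.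
by move=> /negP; rewrite -leNgt => x0; rewrite powker_le0// mul0r.
Qed.

Lemma integral_expRN : (\int[mu]_x (powker 1 x * expR (- x))%:E = 1)%E.
Proof.
transitivity (\int[mu]_(x in `[0%R, +oo[) (expR (- x))%:E)%E.
  rewrite -integral_itv_obnd_cbnd; last first.
    apply/measurable_EFinP; apply: measurable_funTS.
    by apply: measurableT_comp => //; exact: measurable_expR.
  rewrite [RHS]integral_mkcond; apply: eq_integral => x _.
  rewrite patchE powker1E.
  case: ifPn => [|]; rewrite ?inE ?notin_setE /= in_itv/= andbT.
    by move=> ->; rewrite mul1r.
  by move=> /negP/negbTE ->; rewrite mul0r.
have dE (x : R) : is_derive x 1 (fun x : R => - expR (- x)) (expR (- x)).
  by apply: is_derive_eq; rewrite mulrN1 opprK.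
have cE : continuous (fun x : R => - expR (- x)).
  by move=> x; apply/differentiable_continuous/derivable1_diffP.
rewrite (@ge0_continuous_FTC2y _ _ (fun x => - expR (- x)) _ 0)//.
- by rewrite oppr0 expR0 -EFinB sub0r opprK.
- apply: continuous_subspaceT => x; apply: cvg_comp; last exact: continuous_expR.
  exact: cvgN.
- by rewrite -oppr0; apply: cvgN; exact: cvgr_expR.
- by apply: cvg_at_right_filter; exact: cE.
- by move=> x _; rewrite derive1E; apply: derive_val.
Qed.

(** The integrand is below [x `^ (a - 1)] before [1] and, as [a <= 1], below
    [expR (- x)] after [1]. *)
Lemma gamma_integral_lty (a : R) : 0 < a -> a <= 1 ->
  (\int[mu]_x (powker a x * expR (- x))%:E < +oo)%E.
Proof.
move=> a0 a1; pose k x : \bar R := (powker a x * powker 1 (1 - x))%:E.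
pose e x : \bar R := (powker 1 x * expR (- x))%:E.
apply: (@le_lt_trans _ _ (\int[mu]_x (k x + e x))%E).
  apply: ge0_le_integral => //.
  - by move=> x _; exact: gamma_integrand_ge0.
  - exact: measurable_gamma_integrand.
  - apply: emeasurable_funD; first exact: measurable_powker_conv.
    exact: measurable_gamma_integrand.
  move=> x _; rewrite /k /e -EFinD lee_fin !powker1E subr_gt0.
  have [x0|x0] := leP x 0; first by rewrite powker_le0// !mul0r addr0.
  have [x1|x1] := ltP x 1; rewrite ?mulr1 ?mulr0 ?mul1r.
    rewrite -[leLHS]addr0 lerD ?expR_ge0// ler_piMr ?powker_ge0//.
    by rewrite -expR0 ler_expR oppr_le0 ltW.
  rewrite add0r ler_piMl ?expR_ge0// powker_gt0//.
  by rewrite -[leRHS](powRr0 x) ler_powR// subr_le0.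
rewrite ge0_integralD//.
- rewrite /k integral_powker_conv_sym /e integral_expRN lte_add_pinfty ?ltry//.
  exact: integral_powker_lty.
- by move=> x _; rewrite lee_fin mulr_ge0 ?powker_ge0.
- exact: measurable_powker_conv.
- by move=> x _; exact: gamma_integrand_ge0.
- exact: measurable_gamma_integrand.
Qed.

Lemma Gamma_gt0 (a : R) : 0 < a -> a <= 1 -> 0 < Gamma a.
Proof.
move=> a0 a1; rewrite GammaE -lte_fin fineK; last first.
  rewrite ge0_fin_numE ?gamma_integral_lty//.
  by apply: integral_ge0 => x _; exact: gamma_integrand_ge0.
(* a lower bound of the integrand on [[1, 2]] *)
pose m := 2 `^ (a - 1) * expR (- 2) : R.
have m0 : 0 < m by rewrite mulr_gt0 ?powR_gt0 ?expR_gt0.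
apply: (@lt_le_trans _ _ (\int[mu]_(x in `[1%R, 2%R]) (cst m%:E) x)%E).
  rewrite integral_cst//= lebesgue_measure_itv/= lte_fin ltr1n/=.
  by rewrite -EFinD -EFinM lte_fin mulr_gt0// subr_gt0 ltr1n.
rewrite integral_mkcond; apply: ge0_le_integral => //.
- by move=> x _; rewrite patchE; case: ifP => //; rewrite lee_fin ltW.
- by apply/(measurable_restrictT _ _).1.
- exact: measurable_gamma_integrand.
move=> x _; rewrite patchE; case: ifP => [|_]; last exact: gamma_integrand_ge0.
rewrite inE/= in_itv/= => /andP[x1 x2]; rewrite lee_fin /m.
have x0 : 0 < x by exact: lt_le_trans x1.
rewrite powker_gt0// ler_pM ?powR_ge0 ?expR_ge0//; last first.
  by rewrite ler_expR lerN2.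
rewrite -[a - 1]opprB !powRN lef_pV2 ?posrE ?powR_gt0//.
by rewrite ge0_ler_powR// ?nnegrE ?subr_ge0// ltW.
Qed.

(** Euler's first integral at complementary exponents, by writing the product
    of the two Gamma integrals as an integral over the plane and summing along
    the lines on which the sum of the variables is constant. *)
Lemma Gamma_mul_conv (a : R) : 0 < a -> a < 1 ->
  (\int[mu]_x (powker a x * powker (1 - a) (1 - x))%:E =
   (Gamma a * Gamma (1 - a))%:E)%E.
Proof.
move=> a0 a1; set b := 1 - a; set c := LHS.
have b0 : 0 < b by rewrite subr_gt0.
have b1 : b <= 1 by rewrite gerBl ltW.
have mexp (f : R -> R) : measurable_fun setT f ->
    measurable_fun setT (fun x => expR (- f x)).
  by move=> mf; do 2 apply: measurableT_comp => //.
have Gfin e : 0 < e -> e <= 1 ->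
    (\int[mu]_x (powker e x * expR (- x))%:E = (Gamma e)%:E)%E.
  move=> e0 e1; rewrite GammaE fineK// ge0_fin_numE ?gamma_integral_lty//.
  by apply: integral_ge0 => x _; exact: gamma_integrand_ge0.
rewrite EFinM -[X in (_ = _ * X)%E](Gfin b b0 b1).
rewrite -ge0_integralZl//; last 3 first.
- exact: measurable_gamma_integrand.
- by move=> x _; exact: gamma_integrand_ge0.
- by rewrite lee_fin ltW// Gamma_gt0// ltW.
pose K (z : R * R) : \bar R :=
  (powker b z.1 * powker a (z.2 - z.1) * expR (- z.2))%:E.
(* [s] stands for the sum of the variables of the two Gamma integrals *)
transitivity (\int[mu]_x \int[mu]_s K (x, s))%E; last first.
  apply: eq_integral => x _.
  rewrite -(Gfin _ a0 (ltW a1)) muleC -ge0_integralZl//; last 3 first.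
  - exact: measurable_gamma_integrand.
  - by move=> s _; exact: gamma_integrand_ge0.
  - exact: gamma_integrand_ge0.
  rewrite [RHS](@ge0_integral_affine _ _ 1 (- x) (oner_neq0 _)); last 2 first.
  - apply: emeasurable_funM => //; exact: measurable_gamma_integrand.
  - by move=> s; rewrite mule_ge0 ?gamma_integrand_ge0.
  rewrite normr1 mul1e; apply: eq_integral => s _.
  rewrite /K /= mul1r -EFinM; congr EFin.
  have -> : expR (- s) = expR (- x) * expR (- (s - x)).
    by rewrite -expRD; congr expR; ring.
  by ring.
rewrite fubini_tonelli; last 2 first.
- apply/measurable_EFinP; apply: measurable_funM.
    apply: measurable_funM.
      by apply: measurable_fun_powker; exact: measurable_fst.
    by apply: measurable_fun_powker; apply: measurable_funB;
      [exact: measurable_snd|exact: measurable_fst].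
  by apply: measurableT_comp => //; apply: measurableT_comp => //.
- by move=> z; rewrite lee_fin !mulr_ge0 ?powker_ge0 ?expR_ge0.
transitivity (\int[mu]_s (c * (powker 1 s * expR (- s))%:E))%E.
  rewrite ge0_integralZl//; last 3 first.
  - exact: measurable_gamma_integrand.
  - by move=> s _; exact: gamma_integrand_ge0.
  - by apply: integral_ge0 => x _; rewrite lee_fin mulr_ge0 ?powker_ge0.
  by rewrite integral_expRN mule1.
apply: eq_integral => s _; rewrite /K /=.
under eq_integral do rewrite mulrC EFinM.
rewrite ge0_integralZl//; last 2 first.
- exact: measurable_powker_conv.
- by move=> x _; rewrite lee_fin mulr_ge0 ?powker_ge0.
rewrite powker1E; have [s0|s0] := ltP 0 s.
  rewrite mul1r integral_powker_conv_scale// integral_powker_conv_sym -/c.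
  by rewrite /b subrK subrr powRr0 mul1e muleC.
rewrite mul0r mule0 integral0_eq ?mule0// => x _.
have [x0|x0] := leP x 0; first by rewrite powker_le0// mul0r.
by rewrite (powker_le0 a) ?mulr0// subr_le0 (le_trans s0)// ltW.
Qed.

(** The convolution of kernels of complementary orders is constant after [r]:
    this is why fractional integrals of orders [a] and [1 - a] compose to the
    ordinary integral. *)
Lemma integral_powker_conv (a r t : R) : 0 < a -> a < 1 ->
  (\int[mu]_s (powker (1 - a) (s - r) * powker a (t - s))%:E =
   (Gamma a * Gamma (1 - a) * powker 1 (t - r))%:E)%E.
Proof.
move=> a0 a1; rewrite (@ge0_integral_affine _ _ 1 r (oner_neq0 _)); last 2 first.
- apply/measurable_EFinP; apply: measurable_funM.
    by apply: measurable_fun_powker; apply: measurable_funB.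
  by apply: measurable_fun_powker; apply: measurable_funB.
- by move=> s; rewrite lee_fin mulr_ge0 ?powker_ge0.
rewrite normr1 mul1e.
under eq_integral => s _.
  have -> : 1 * s + r - r = s by ring.
  have -> : t - (1 * s + r) = t - r - s by ring.
  over.
rewrite powker1E; have [tr|tr] := ltP 0 (t - r).
  rewrite integral_powker_conv_scale// integral_powker_conv_sym.
  by rewrite Gamma_mul_conv// subrK subrr powRr0 mul1e mulr1.
rewrite mulr0 integral0_eq// => s _.
have [s0|s0] := leP s 0; first by rewrite powker_le0// mul0r.
by rewrite (powker_le0 a) ?mulr0// subr_le0 (le_trans tr)// ltW.
Qed.

End gamma.

(** * Integrability of powers of the kernel *)

Section hoelder_bound.
Context {d} {T : measurableType d} {R : realType}.
Variable mu : {measure set T -> \bar R}.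

(** Hoelder's inequality in the form in which it is applied here, with real bounds
    for the norms of the factors. *)
Lemma hoelder_bound (p q A B : R) (f g : T -> R) :
  0 < p -> 0 < q -> p^-1 + q^-1 = 1 -> 0 <= A -> 0 <= B ->
  measurable_fun setT f -> measurable_fun setT g ->
  (\int[mu]_x (`|f x| `^ p)%:E <= (A `^ p)%:E)%E ->
  (\int[mu]_x (`|g x| `^ q)%:E <= (B `^ q)%:E)%E ->
  (\int[mu]_x `|(f x * g x)%:E| <= (A * B)%:E)%E.
Proof.
move=> p0 q0 pq A0 B0 mf mg fA gB.
have root (r e : R) (u : T -> R) : 0 < r -> 0 <= e ->
    (\int[mu]_x (`|u x| `^ r)%:E <= (e `^ r)%:E)%E ->
    ('N[mu]_r%:E[EFin \o u] <= e%:E)%E.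
  move=> r0 e0 ue; rewrite unlock /Lnorm.
  have -> : e%:E = ((e `^ r)%:E `^ r^-1)%E.
    by rewrite poweR_EFin -powRrM mulfV ?gt_eqF// powRr1.
  apply: gt0_ler_poweR => //; rewrite ?in_itv/= ?leey ?andbT ?lee_fin ?powR_ge0//.
  - by rewrite invr_ge0 ltW.
  - by apply: integral_ge0 => x _; rewrite ?poweR_ge0 ?lee_fin ?powR_ge0.
have := hoelder mu mf mg p0 q0 pq.
rewrite Lnorm1 => /le_trans; apply.
rewrite EFinM; apply: lee_pmul; rewrite ?Lnorm_ge0//.
- exact: root.
- exact: root.
Qed.

End hoelder_bound.

Section kernel_estimates.
Context {R : realType}.
Local Notation mu := (@lebesgue_measure R).

Lemma powker_powR (a q x : R) : 0 < q ->
  powker a x `^ q = powker ((a - 1) * q + 1) x.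
Proof.
move=> q0; rewrite /powker; case: ifP => _; last by rewrite powR0 ?gt_eqF.
by rewrite -powRrM addrK.
Qed.

Lemma powker_anti (a x y : R) : a <= 1 -> 0 < x -> x <= y ->
  powker a y <= powker a x.
Proof.
move=> a1 x0 xy; have y0 : 0 < y by exact: lt_le_trans xy.
rewrite !powker_gt0// -[a - 1]opprB !powRN lef_pV2 ?posrE ?powR_gt0//.
by rewrite ge0_ler_powR// ?nnegrE ?subr_ge0// ltW.
Qed.

(** Divide by [A `^ q] and use [x `^ q <= x] on [[0, 1]]. *)
Lemma powRB_superadd (q A B : R) : 1 <= q -> 0 <= B -> B <= A ->
  (A - B) `^ q + B `^ q <= A `^ q.
Proof.
move=> q1 B0 BA; have A0 : 0 <= A by exact: le_trans BA.
have q0 : 0 < q by exact: lt_le_trans q1.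
have [A00|An0] := eqVneq A 0.
  have -> : B = 0 by apply/eqP; rewrite eq_le B0 andbT -A00.
  by rewrite A00 subrr powR0 ?gt_eqF// addr0.
have Agt0 : 0 < A by rewrite lt_neqAle eq_sym An0.
have sub x : 0 <= x -> x <= A -> x `^ q <= x * A `^ (q - 1).
  move=> x0 xA; have -> : x = A * (x / A) by rewrite mulrC divfK.
  have xA0 : 0 <= x / A by rewrite divr_ge0.
  have -> : A * (x / A) * A `^ (q - 1) = A `^ q * (x / A).
    by rewrite -(mulr_powRB1 A0 q0); ring.
  rewrite powRM// ler_wpM2l ?powR_ge0//.
  have [->|xn0] := eqVneq (x / A) 0; first by rewrite powR0 ?gt_eqF.
  apply: ge1r_powR => //; rewrite lt_neqAle eq_sym xn0 xA0/=.
  by rewrite ler_pdivrMr// mul1r.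
rewrite -(mulr_powRB1 A0)//.
apply: (@le_trans _ _ ((A - B) * A `^ (q - 1) + B * A `^ (q - 1))).
  by rewrite lerD// sub// ?subr_ge0// lerBlDr lerDl.
by rewrite -mulrDl subrK.
Qed.

Lemma powker_itv_Lq (a q : R) : 0 < q -> 0 < (a - 1) * q + 1 ->
  exists2 c : R, 0 <= c & forall t, 0 <= t ->
    (\int[mu]_r (`|powker 1 r * powker a (t - r)| `^ q)%:E =
     (c * t `^ ((a - 1) * q + 1))%:E)%E.
Proof.
move=> q0 g0; have [c c0 cE] := integral_powker _ g0; exists c => // t t0.
rewrite -cE//; apply: eq_integral => r _; congr EFin.
rewrite ger0_norm ?mulr_ge0 ?powker_ge0// powRM ?powker_ge0//.
by rewrite !powker_powR// subrr mul0r add0r.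
Qed.

(** By superadditivity, the [q]-th power of the difference of two translates of
    the kernel is at most the difference of their [q]-th powers, which are again
    kernels; the integrals of the latter telescope up to [(t - s) `^ g]. *)
Lemma powker_diff_Lq (a q : R) : a <= 1 -> 1 <= q -> 0 < (a - 1) * q + 1 ->
  exists2 c : R, 0 <= c & forall s t, 0 <= s -> s <= t ->
    (\int[mu]_r (`|powker 1 r * (powker a (t - r) - powker a (s - r))| `^ q)%:E
     <= (c * (t - s) `^ ((a - 1) * q + 1))%:E)%E.
Proof.
move=> a1 q1; set g := (a - 1) * q + 1 => g0.
have q0 : 0 < q by exact: lt_le_trans q1.
have [c c0 cE] := integral_powker _ g0.
exists (2 * c) => [|s t s0 st]; first by rewrite mulr_ge0.
have t0 : 0 <= t by exact: le_trans st.
pose D r := powker 1 r * (powker a (t - r) - powker a (s - r)).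
pose K u r : \bar R := (powker 1 r * powker g (u - r))%:E.
pose H r : \bar R := (powker 1 (r - s) * powker g (t - r))%:E.
have mD : measurable_fun setT (fun r => (`|D r| `^ q)%:E).
  apply/measurable_EFinP.
  apply: (@measurableT_comp _ _ _ _ _ _ (@powR R ^~ q)).
    exact: measurable_powR.
  apply: measurableT_comp => //; apply: measurable_funM.
    exact: measurable_powker.
  by apply: measurable_funB; apply: measurable_fun_powker; apply: measurable_funB.
have mK u : measurable_fun setT (K u) by exact: measurable_powker_conv.
have mH : measurable_fun setT H.
  apply/measurable_EFinP; apply: measurable_funM; apply: measurable_fun_powker;
  exact: measurable_funB.
have K0 u r : (0 <= K u r)%E by rewrite lee_fin mulr_ge0 ?powker_ge0.
have H0 r : (0 <= H r)%E by rewrite lee_fin mulr_ge0 ?powker_ge0.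
have HE : (\int[mu]_r H r = (c * (t - s) `^ g)%:E)%E.
  have ts0 : 0 <= t - s by rewrite subr_ge0.
  rewrite -(cE _ ts0) (@ge0_integral_affine _ _ 1 s (oner_neq0 _) mH H0).
  rewrite normr1 mul1e; apply: eq_integral => r _; rewrite /H.
  by congr (powker _ _ * powker _ _)%:E; ring.
(* The comparison of the integrands fails at [r = s], where both kernels on the
   right-hand side vanish. *)
have le_int : (\int[mu]_r ((`|D r| `^ q)%:E + K t r) <=
    \int[mu]_r (K s r + (H r + H r)))%E.
  apply: ae_ge0_le_integral => //.
  - by move=> r _; rewrite adde_ge0// lee_fin powR_ge0.
  - by apply: emeasurable_funD => //; exact: mK.
  - by move=> r _; rewrite !adde_ge0.
  - apply: emeasurable_funD; first exact: mK.
    by apply: emeasurable_funD; exact: mH.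
  - exists [set s]; split => //; first exact: lebesgue_measure_set1.
    move=> r /= h; apply: contrapT => rs; apply: h => _; move/eqP: rs => rs.
    rewrite /K /H -!EFinD lee_fin /D !powker1E.
    have [r0|r0] := ltP 0 r; last first.
      rewrite !mul0r normr0 powR0 ?gt_eqF// !add0r.
      by rewrite addr_ge0 ?mulr_ge0 ?powker_ge0 ?ler0n.
    rewrite !mul1r subr_gt0; have [sr|sr|/eqP] := ltgtP s r; last first.
    + by rewrite eq_sym (negbTE rs).
    + rewrite mul0r !addr0 -!powker_powR// distrC ger0_norm ?subr_ge0.
        apply: powRB_superadd => //; first exact: powker_ge0.
        by apply: powker_anti => //; rewrite ?subr_gt0// lerB.
      by apply: powker_anti => //; rewrite ?subr_gt0// lerB.
    + rewrite [powker a (s - r)]powker_le0; last by rewrite subr_le0 ltW.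
      rewrite subr0.
      rewrite ger0_norm ?powker_ge0// powker_powR// mul1r.
      by rewrite lerDr powker_ge0.
move: le_int; rewrite ge0_integralD//; last exact: mK.
rewrite [leRHS]ge0_integralD//; last 3 first.
- exact: mK.
- by move=> r _; rewrite adde_ge0.
- by apply: emeasurable_funD.
rewrite [X in (_ <= _ + X)%E]ge0_integralD//.
rewrite !cE// HE -!EFinD => le_int.
have le_st : c * s `^ g <= c * t `^ g.
  by rewrite ler_wpM2l// ge0_ler_powR// ltW.
rewrite -(@leeD2rE _ (c * t `^ g)%:E)//; apply: le_trans le_int _.
by rewrite -EFinD lee_fin; lra.
Qed.

End kernel_estimates.

(** * Fractional integrals *)

Section riemann_liouville.
Context {R : realType}.
Local Notation mu := (@lebesgue_measure R).

Lemma lmeasurable_rep (D : set R) (g : R -> R) : measurable D ->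
  lmeasurable D g ->
  exists h : R -> R, [/\ measurable_fun setT h, forall x, ~ D x -> h x = 0 &
    ae_eq mu D g h].
Proof.
move=> mD [h mh gh]; exists (h \_ D); split.
- exact/(measurable_restrictT _ _).1.
- by move=> x Dx; rewrite patchE memNset.
- apply: filterS gh => x ghx Dx.
  by rewrite ghx// patchE mem_set.
Qed.

Lemma RL_integral_congr_ae (a d t : R) (g h : R -> R) : t <= d ->
  ae_eq mu `]0, d[%classic g h -> RL_integral a g t = RL_integral a h t.
Proof.
move=> td gh; rewrite /RL_integral /Rintegral; congr (_ * fine _).
apply: integral_congr_ae; apply: filterS gh => s gh.
rewrite /= in_itv/= => /andP[s0 st]; rewrite gh//= in_itv/= s0.
exact: lt_le_trans td.
Qed.

Lemma RL_integralE (a t : R) (h : R -> R) : RL_integral a h t =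
  (Gamma a)^-1 * \int[mu]_s (h s * (powker 1 s * powker a (t - s))).
Proof.
rewrite /RL_integral Rintegral_mkcond; congr (_ * _).
apply: eq_Rintegral => s _; rewrite patchE.
case: ifPn => [|]; rewrite ?inE ?notin_setE /= in_itv/=.
  move=> /andP[s0 st]; rewrite powker1E s0 mul1r powker_gt0 ?subr_gt0//.
  by rewrite -[a - 1]opprB powRN.
move=> /negP; rewrite negb_and -!leNgt => /orP[s0|st].
  by rewrite (powker_le0 1)// mul0r mulr0.
by rewrite (powker_le0 a) ?subr_le0// !mulr0.
Qed.

Lemma RL_integral_le0 (a t : R) (h : R -> R) : t <= 0 -> RL_integral a h t = 0.
Proof.
move=> t0; rewrite /RL_integral set_itv_ge ?Rintegral_set0 ?mulr0//.
by rewrite bnd_simp -leNgt.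
Qed.

Lemma measurable_RL_kernel (a t : R) :
  measurable_fun setT (fun s => powker 1 s * powker a (t - s) : R).
Proof. by apply/measurable_EFinP; exact: measurable_powker_conv. Qed.

(** Hoelder's inequality against the kernel: the condition [p^-1 < a] says that
    the conjugate power of the kernel is integrable near zero. *)
Lemma RL_holder_rep (p a : R) : 1 < p -> p^-1 < a -> a <= 1 ->
  exists C k : R, [/\ 0 <= C, 0 < k &
  forall (h : R -> R) (A : R), 0 <= A -> measurable_fun setT h ->
    (\int[mu]_s (`|h s| `^ p)%:E <= (A `^ p)%:E)%E ->
    (forall t, 0 <= t -> mu.-integrable setT
       (fun s => (h s * (powker 1 s * powker a (t - s)))%:E)) /\
    (forall s t, 0 <= s -> s <= t ->
       `|RL_integral a h t - RL_integral a h s| <= C * A * (t - s) `^ k)].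
Proof.
move=> p1 pa a1; have p0 : 0 < p by exact: lt_trans p1.
have pm1 : 0 < p - 1 by rewrite subr_gt0.
pose q := p / (p - 1).
have q1 : 1 <= q by rewrite ler_pdivlMr// mul1r gerBl.
have q0 : 0 < q by exact: lt_le_trans q1.
have pq : p^-1 + q^-1 = 1.
  by rewrite /q; field; rewrite !gt_eqF.
pose g := (a - 1) * q + 1.
have g0 : 0 < g.
  rewrite /g -[X in _ + X](@divff _ q) ?gt_eqF// [q / q]mulrC -mulrDl.
  by rewrite mulr_gt0//; move: pq pa; lra.
have [c c0 cE] := powker_itv_Lq a q q0 g0.
have [c' c'0 c'E] := powker_diff_Lq a q a1 q1 g0.
have root (e : R) : 0 <= e -> (e `^ q^-1) `^ q = e.
  by move=> e0; rewrite -powRrM mulVf ?gt_eqF// powRr1.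
have mD s t : measurable_fun setT
    (fun r => powker 1 r * (powker a (t - r) - powker a (s - r)) : R).
  apply: measurable_funM; first exact: measurable_powker.
  by apply: measurable_funB; apply: measurable_fun_powker; apply: measurable_funB.
exists ((Gamma a)^-1 * c' `^ q^-1), (g / q); split.
- rewrite mulr_ge0 ?powR_ge0// invr_ge0 ltW// Gamma_gt0//.
  by rewrite (lt_trans _ pa)// invr_gt0.
- by rewrite divr_gt0.
move=> h A A0 mh hA.
have int t : 0 <= t -> mu.-integrable setT
    (fun s => (h s * (powker 1 s * powker a (t - s)))%:E).
  move=> t0; apply/integrableP; split.
    apply/measurable_EFinP; apply: measurable_funM => //.
    exact: measurable_RL_kernel.
  apply: (@le_lt_trans _ _ (A * (c * t `^ g) `^ q^-1)%:E); last exact: ltry.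
  apply: (hoelder_bound _ p q) => //; first exact: powR_ge0.
    exact: measurable_RL_kernel.
  by rewrite cE// root// mulr_ge0// powR_ge0.
split=> // s t s0 st; rewrite !RL_integralE -mulrBr normrM.
have t0 : 0 <= t by exact: le_trans st.
have G0 : 0 <= (Gamma a)^-1.
  by rewrite invr_ge0 ltW// Gamma_gt0// (lt_trans _ pa)// invr_gt0.
rewrite ger0_norm// -!mulrA ler_wpM2l// -RintegralB//; last 2 first.
- exact: int.
- exact: int.
rewrite -lee_fin.
pose D r := h r * (powker 1 r * (powker a (t - r) - powker a (s - r))).
have -> : \int[mu]_r (h r * (powker 1 r * powker a (t - r)) -
    h r * (powker 1 r * powker a (s - r))) = \int[mu]_r D r.
  by apply: eq_Rintegral => r _; rewrite /D; ring.
have iD : mu.-integrable setT (EFin \o D).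
  have -> : EFin \o D = ((fun r => (h r * (powker 1 r * powker a (t - r)))%:E) \-
    (fun r => (h r * (powker 1 r * powker a (s - r)))%:E))%E.
    by apply/funext => r; rewrite /= -EFinB; congr EFin; rewrite /D; ring.
  by apply: integrableB => //; exact: int.
apply: (@le_trans _ _ (\int[mu]_r `|(D r)%:E|)%E).
  rewrite -abse_EFin /Rintegral fineK; last exact: integrable_fin_num.
  by apply: le_abse_integral => //; exact: measurable_int iD.
have -> : c' `^ q^-1 * (A * (t - s) `^ (g / q)) = A * (c' * (t - s) `^ g) `^ q^-1.
  by rewrite powRM ?powR_ge0// -powRrM; ring.
apply: (hoelder_bound _ p q) => //; first exact: powR_ge0.
  exact: mD.
by rewrite root ?c'E// mulr_ge0// powR_ge0.
Qed.

End riemann_liouville.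

Section fractional_integrals.
Context {R : realType}.
Local Notation mu := (@lebesgue_measure R).

Lemma integral_Lp_rep (p d : R) (g h : R -> R) : p != 0 ->
  (forall x : R, ~ `]0, d[%classic x -> h x = 0) -> ae_eq mu `]0, d[%classic g h ->
  (\int[mu]_s (`|h s| `^ p)%:E = \int[mu]_(s in `]0%R, d[) (`|g s| `^ p)%:E)%E.
Proof.
move=> p0 h0 gh.
transitivity (\int[mu]_(s in `]0%R, d[) (`|h s| `^ p)%:E)%E.
  rewrite [RHS]integral_mkcond; apply: eq_integral => s _.
  rewrite patchE; case: ifPn => //; rewrite notin_setE => /h0 ->.
  by rewrite normr0 powR0.
by apply: integral_congr_ae; apply: filterS gh => s gh sd; rewrite gh.
Qed.

Lemma RL_holder (p a : R) : 1 < p -> p^-1 < a -> a <= 1 ->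
  exists C k : R, [/\ 0 <= C, 0 < k &
  forall (d : R) (g : R -> R) (A : R), 0 <= A -> lmeasurable `]0, d[%classic g ->
    (\int[mu]_(s in `]0%R, d[) (`|g s| `^ p)%:E <= (A `^ p)%:E)%E ->
    forall s t, 0 <= s -> s <= t -> t <= d ->
    `|RL_integral a g t - RL_integral a g s| <= C * A * (t - s) `^ k].
Proof.
move=> p1 pa a1; have [C [k [C0 k0 H]]] := RL_holder_rep p a p1 pa a1.
exists C, k; split=> // d g A A0 mg gA s t s0 st td.
have [h [mh h0 gh]] := lmeasurable_rep _ _ (measurable_itv _) mg.
rewrite (RL_integral_congr_ae a d t g h)// (RL_integral_congr_ae a d s g h)//; last first.
  exact: le_trans td.
have p0 : p != 0 by rewrite gt_eqF// (lt_trans _ p1).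
rewrite -(integral_Lp_rep p d g h p0 h0 gh) in gA.
exact: (H h A A0 mh gA).2 s t s0 st.
Qed.

Lemma RL_integralB (p a d t : R) (g1 g2 : R -> R) (A : R) :
  1 < p -> p^-1 < a -> a <= 1 -> 0 <= A ->
  lmeasurable `]0, d[%classic g1 -> lmeasurable `]0, d[%classic g2 ->
  (\int[mu]_(s in `]0%R, d[) (`|g1 s| `^ p)%:E <= (A `^ p)%:E)%E ->
  (\int[mu]_(s in `]0%R, d[) (`|g2 s| `^ p)%:E <= (A `^ p)%:E)%E ->
  0 <= t -> t <= d ->
  RL_integral a (g1 \- g2) t = RL_integral a g1 t - RL_integral a g2 t.
Proof.
move=> p1 pa a1 A0 mg1 mg2 g1A g2A t0 td.
have [C [k [C0 k0 H]]] := RL_holder_rep p a p1 pa a1.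
have p0 : p != 0 by rewrite gt_eqF// (lt_trans _ p1).
have [h1 [mh1 h10 gh1]] := lmeasurable_rep _ _ (measurable_itv _) mg1.
have [h2 [mh2 h20 gh2]] := lmeasurable_rep _ _ (measurable_itv _) mg2.
rewrite (RL_integral_congr_ae a d t g1 h1)// (RL_integral_congr_ae a d t g2 h2)//.
rewrite (RL_integral_congr_ae a d t (g1 \- g2) (h1 \- h2))//; last first.
  by apply: filterS2 gh1 gh2 => s gh1 gh2 sd; rewrite /= gh1// gh2.
rewrite -(integral_Lp_rep _ _ _ _ p0 h10 gh1) in g1A.
rewrite -(integral_Lp_rep _ _ _ _ p0 h20 gh2) in g2A.
rewrite !RL_integralE -mulrBr -RintegralB//; last 2 first.
- exact: (H h1 A A0 mh1 g1A).1.
- exact: (H h2 A A0 mh2 g2A).1.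
by congr (_ * _); apply: eq_Rintegral => s _; rewrite /= mulrBl.
Qed.

(** The fractional integrals of complementary orders compose to the ordinary
    one: exchange the order of integration and use Euler's first integral. *)
Lemma RL_integral_compl (a t : R) (h : R -> R) : 0 < a -> a < 1 ->
  mu.-integrable setT (EFin \o h) ->
  RL_integral a (RL_integral (1 - a) h) t = \int[mu]_(s in `]0, t[) h s.
Proof.
move=> a0 a1 ih.
have mh : measurable_fun setT h by apply/measurable_EFinP; exact: measurable_int ih.
set b := 1 - a.
have b0 : 0 < b by rewrite subr_gt0.
have b1 : b <= 1 by rewrite gerBl ltW.
have Ga : Gamma a != 0 by rewrite gt_eqF// Gamma_gt0// ltW.
have Gb : Gamma b != 0 by rewrite gt_eqF// Gamma_gt0.
pose G := Gamma a * Gamma b.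
have G0 : 0 <= G by rewrite mulr_ge0// ltW// Gamma_gt0// ltW.
pose k s r := powker b (s - r) * powker a (t - s) : R.
have k0 s r : 0 <= k s r by rewrite mulr_ge0 ?powker_ge0.
have mk r : measurable_fun setT (fun s => (k s r)%:E).
  apply/measurable_EFinP; apply: measurable_funM; apply: measurable_fun_powker;
  exact: measurable_funB.
have kE r : (\int[mu]_s (k s r)%:E = (G * powker 1 (t - r))%:E)%E.
  exact: integral_powker_conv.
pose K (z : R * R) : \bar R := (h z.2 * powker 1 z.2 * k z.1 z.2)%:E.
have mK : measurable_fun setT K.
  apply/measurable_EFinP; apply: measurable_funM.
    apply: measurable_funM; first by apply: measurableT_comp => //.
    by apply: measurable_fun_powker.
  apply: measurable_funM; apply: measurable_fun_powker; apply: measurable_funB => //.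
have iK : (mu \x mu)%E.-integrable setT K.
  refine ((integrable21ltyP mu mu mK).2 _).
  apply: (@le_lt_trans _ _ (\int[mu]_r (G%:E * `|(h r)%:E|))%E); last first.
    rewrite ge0_integralZl//; last first.
      by apply: measurableT_comp => //; exact/measurable_EFinP.
    by rewrite lte_mul_pinfty// ?lee_fin//; case/integrableP : ih.
  apply: ge0_le_integral => //.
  - by move=> r _; exact: integral_ge0.
  - have mKabs : measurable_fun setT (abse \o K) by apply: measurableT_comp.
    apply: (measurable_fun_fubini_tonelli_G (m1 := mu) _ mKabs) => z.
    exact: abse_ge0.
  - apply: emeasurable_funM => //; apply: measurableT_comp => //.
    exact/measurable_EFinP.
  move=> r _.
  under eq_integral.
    move=> s _; rewrite /K /= normrM EFinM (ger0_norm (k0 _ _)).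
    over.
  rewrite ge0_integralZl//; last 2 first.
  - exact: mk.
  - by move=> s _; rewrite lee_fin.
  rewrite kE -!EFinM lee_fin !powker1E normrM (ger0_norm (ler0n _ _)).
  have le1 (e : bool) : e%:R <= 1 :> R by case: e.
  apply: (@le_trans _ _ (`|h r| * 1 * (G * 1))); last by rewrite !mulr1 mulrC.
  by apply: ler_pM => //; rewrite ?ler_wpM2l// mulr_ge0// ler0n.
(* the inner integral after the exchange is the constant [G] up to [t] *)
have inner r : (\int[mu]_s K (s, r) =
    G%:E * ((EFin \o h) \_ `]0%R, t[) r)%E.
  transitivity ((h r * powker 1 r)%:E * \int[mu]_s (k s r)%:E)%E.
    rewrite -integralZl//; apply/integrableP; split; first exact: mk.
    under eq_integral do rewrite gee0_abs ?lee_fin ?k0//.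
    by rewrite kE ltry.
  rewrite kE !powker1E subr_gt0 patchE.
  case: ifPn => [|]; rewrite ?inE ?notin_setE /= in_itv/=.
    by move=> /andP[-> ->]; rewrite -!EFinM; congr EFin; rewrite /=; ring.
  move=> /negP; rewrite negb_and => /orP[/negbTE->|/negbTE->].
    by rewrite mulr0 mul0e mule0.
  by rewrite mulr0 !mule0.
rewrite RL_integralE /Rintegral.
have -> : (\int[mu]_s (RL_integral b h s * (powker 1 s * powker a (t - s)))%:E =
    \int[mu]_s ((Gamma b)^-1%:E * \int[mu]_r K (s, r)))%E.
  apply: integral_congr_ae.
  have := ae_integrable1 iK; apply: filterS => s iKs _.
  rewrite RL_integralE; set c := powker a (t - s).
  have [c0|c0] := eqVneq c 0.
    rewrite c0 !mulr0 integral0_eq ?mule0// => r _.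
    by rewrite /K /k /= -/c c0 !mulr0.
  pose L r := h r * (powker 1 r * powker b (s - r)).
  have KL r : K (s, r) = (c%:E * (L r)%:E)%E.
    by rewrite /K /k /L /= -/c -EFinM; congr EFin; ring.
  have iL : mu.-integrable setT (EFin \o L).
    apply: eq_integrable (integrableZl measurableT c^-1 iKs) => // r _.
    by rewrite KL -!EFinM mulKf.
  under [in RHS]eq_integral do rewrite KL.
  rewrite integralZl// -[X in (_ = _ * (_ * X))%E]fineK; last exact: integrable_fin_num.
  rewrite -!EFinM -/(Rintegral _ _ _) -mulrA; congr (_ * _)%:E.
  rewrite powker1E; have [s0|s0] := ltP 0 s; first by rewrite mul1r mulrC.
  rewrite mul0r mulr0 /Rintegral integral0_eq ?mulr0// => r _.
  rewrite /L; have [r0|r0] := leP r 0; first by rewrite powker_le0// mul0r mulr0.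
  by rewrite (powker_le0 b) ?mulr0// subr_le0 (le_trans s0)// ltW.
have iF := integrable_fubini_F iK.
have FE : (\int[mu]_s \int[mu]_r K (s, r) =
    \int[mu]_r (G%:E * ((EFin \o h) \_ `]0%R, t[) r))%E.
  by rewrite (Fubini iK); apply: eq_integral => r _; exact: inner.
rewrite integralZl// FE.
have mI : measurable `]0, t[%classic by exact: measurable_itv.
rewrite integralZl//; last first.
  by apply/(integrable_mkcond _ _).1 => //; apply: integrableS ih.
rewrite -integral_mkcond -[X in (_ * (_ * X))%E]fineK; last first.
  by apply: integrable_fin_num => //; apply: integrableS ih.
have cancel x y z : x != 0 -> y != 0 -> x^-1 * (y^-1 * (x * y * z)) = z :> R.
  by move=> x0 y0; field; rewrite x0 y0.
by rewrite -!EFinM /=; exact: cancel.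
Qed.

End fractional_integrals.

(** * Absolutely continuous functions *)

Section absolutely_continuous_const.
Context {R : realType}.
Local Notation mu := (@lebesgue_measure R).

Lemma derive1_eq0_near (G : R -> R) (x e : R) : 0 < e ->
  derivable G x 1 -> derive1 G x = 0 ->
  exists2 r : R, 0 < r & forall y, `|y - x| < r -> `|G y - G x| <= e * `|y - x|.
Proof.
move=> e0 dG G'0.
have : h^-1 *: ((G \o shift x) (h *: 1) - G x) @[h --> (0 : R)^'] --> (0 : R).
  by rewrite -[X in _ --> X]G'0 derive1E; exact: dG.
move=> /cvgr0Pnorm_lt/(_ _ e0) [r /= r0 H]; exists r => // y yr.
have [->|yx] := eqVneq y x; first by rewrite !subrr normr0 mulr0.
have yx0 : y - x != 0 by rewrite subr_eq0.
have := H (y - x); rewrite /= sub0r normrN => /(_ yr yx0) /ltW.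
rewrite [_ *: 1]mulr1 subrK normrZ normfV ler_pdivrMl ?normr_gt0//.
by rewrite mulrC.
Qed.

Lemma sum_length_le (U : set R) (n : nat) (a b : 'I_n -> R) : measurable U ->
  (forall i, a i < b i) -> (forall i, `]a i, b i[ `<=` U) ->
  trivIset setT (fun i => `]a i, b i[%classic) ->
  ((\sum_(i < n) (b i - a i))%:E <= mu U)%E.
Proof.
move=> mU ab abU tab.
pose r := index_enum ('I_n : finType).
have ur : uniq r by exact: index_enum_uniq.
have -> : ((\sum_(i < n) (b i - a i))%:E =
    mu (\big[setU/set0]_(i \in [set` r]) `]a i, b i[%classic))%E.
  rewrite measure_fsbig//=; last exact: sub_trivIset tab.
  rewrite -fsbig_seq// -sumEFin; apply: eq_bigr => i _.
  by rewrite lebesgue_measure_itv/= lte_fin ab -EFinB.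
rewrite fsbig_setU//; apply: le_measure; rewrite ?inE//.
  by apply: fin_bigcup_measurable => // i _; exact: measurable_itv.
by apply: bigcup_sub => i _.
Qed.

(** Cover the exceptional null set by an open set [U] of small measure. Every
    point of [[a, b]] has a neighbourhood in which an interval around it either
    is contained in [U] or has an increment of [G] at most [e] times its length.
    Continuous induction along [[a, b]] then compares [G b - G a] with
    [e * (b - a)] plus the increments of [G] over finitely many disjoint
    intervals inside [U], to which absolute continuity applies. *)
Lemma absolutely_continuous_derive0_le (l r a b : R) (G : R -> R) (e : R) :
  absolutely_continuous `]l, r[ G ->
  {ae mu, forall t, t \in `]l, r[ -> derivable G t 1 /\ derive1 G t = 0} ->
  l < a -> a <= b -> b < r -> 0 < e -> `|G b - G a| <= e * (b - a) + e.
Proof.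
move=> acG [N [mN N0 GN]] la ab br e0.
have [d d0 acd] := acG _ e0.
have muN0 : mu N = 0%E by exact: N0.
have Noo : (mu N < +oo)%E by rewrite muN0.
have [U [oU NU UN]] := lebesgue_regularity_outer mN Noo d0.
have mU : measurable U by exact: open_measurable.
have Ud : (mu U < d%:E)%E.
  rewrite -(setDUK NU) measureU//=.
  - by rewrite muN0 add0e.
  - exact: measurableD.
  - by rewrite setDIK.
pose lenG (p : R * R) := `|G p.2 - G p.1|.
(* the property propagated by the continuous induction *)
pose P x := exists s : seq (R * R),
  [/\ forall p, p \in s -> [/\ a <= p.1, p.1 < p.2, p.2 <= x & `]p.1, p.2[ `<=` U],
      pairwise (fun p q : R * R => q.2 <= p.1) s &
      `|G x - G a| <= e * (x - a) + \sum_(p <- s) lenG p].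
have step x : a <= x -> x <= b -> exists2 rho, 0 < rho &
    forall y z, a <= y -> y <= x -> x <= z -> y < z -> x - rho < y -> z < x + rho ->
      P y -> P z.
  move=> ax xb.
  have xlr : x \in `]l, r[ by rewrite in_itv/= (lt_le_trans la ax) (le_lt_trans xb br).
  have [Nx|Nx] := pselect (N x).
    have /nbhs_ballP[rho /= rho0 xrho] : nbhs x U.
      by apply: open_nbhs_nbhs; split=> //; exact: NU.
    exists rho => // y z ay yx xz yz xy zx [s [sP sd sG]].
    exists ((y, z) :: s); split.
    - move=> p; rewrite inE => /predU1P[->|/sP[? ? ? ?]]; split => //=.
        move=> u; rewrite /= in_itv/= => /andP[yu uz]; apply: xrho.
        rewrite /ball/= distrC ltr_distl (lt_trans xy yu)/=.
        exact: lt_trans zx.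
      by rewrite (le_trans _ (ltW yz)).
    - by rewrite /= sd andbT; apply/allP => p /sP[].
    - rewrite big_cons /lenG/=.
      have := ler_distD (G y) (G z) (G a); move: sG.
      have : e * (y - a) <= e * (z - a) by rewrite ler_wpM2l ?lerB// ltW.
      by lra.
  have [dG G'0] : derivable G x 1 /\ derive1 G x = 0.
    by apply: contrapT => h; apply: Nx; apply: GN => /(_ xlr).
  have [rho rho0 H] := derive1_eq0_near G x e e0 dG G'0.
  exists rho => // y z ay yx xz yz xy zx [s [sP sd sG]].
  exists s; split => //.
    by move=> p /sP[? ? ? ?]; split => //; rewrite (le_trans _ (ltW yz)).
  have /H : `|y - x| < rho by rewrite ltr_distl xy (le_lt_trans yx)// ltrDl.
  have /H : `|z - x| < rho by rewrite ltr_distl zx (lt_le_trans _ xz)// gtrBl.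
  rewrite [`|z - x|]ger0_norm ?subr_ge0// [`|y - x|]ler0_norm ?subr_le0//.
  move=> Hz Hy.
  have := ler_distD (G y) (G z) (G a); have := ler_distD (G x) (G z) (G y).
  by rewrite [`|G x - G y|]distrC; lra.
have Pa : P a.
  exists [::]; split => //; by rewrite subrr normr0 big_nil subrr mulr0 addr0.
pose S := [set x | [/\ a <= x, x <= b & P x]].
have Sa : S a by split.
have supS : has_sup S by split; [exists a|exists b => x [_ xb _]].
have Pb : P b.
  set x := sup S.
  have ax : a <= x by apply: sup_upper_bound.
  have xb : x <= b by apply: ge_sup => [|y []//]; exists a.
  have [rho rho0 H] := step x ax xb.
  have [y [ay yb Py] xy] := sup_adherent rho0 supS.
  have yx : y <= x by apply: sup_upper_bound.
  pose z := Num.min b (x + rho / 2).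
  have xz : x <= z by rewrite le_min xb/=; lra.
  have zb : z <= b by rewrite ge_min lexx.
  have zE : z = b \/ z = x + rho / 2.
    by rewrite /z; case: leP => _; [left|right].
  have [yz|zy] := ltP y z; last first.
    have -> // : b = y.
    case: zE => zE; last by move: xz zy yx; rewrite zE; lra.
    by apply/eqP; rewrite eq_le yb andbT -zE.
  have zx : z < x + rho by rewrite gt_min; apply/orP; right; lra.
  have Pz : P z by exact: (H y z).
  have : z <= x by apply: sup_upper_bound => //; split => //; exact: le_trans xz.
  by case: zE => [<-//|->]; lra.
have [s [sP sd sG]] := Pb.
apply: (le_trans sG); rewrite lerD2l; apply: ltW.
pose u (i : 'I_(size s)) := (nth (0, 0) s i).1.
pose v (i : 'I_(size s)) := (nth (0, 0) s i).2.
have inS (i : 'I_(size s)) : nth (0, 0) s i \in s by exact: mem_nth.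
have tuv : trivIset setT (fun i => `]u i, v i[%classic).
  have lt_disj (i j : 'I_(size s)) : (i < j)%N ->
      `]u i, v i[%classic `&` `]u j, v j[%classic = set0.
    move=> ij; have vu : v j <= u i.
      by apply: (pairwiseP (0, 0) sd); rewrite ?inE.
    apply/seteqP; split => // x /=; rewrite !in_itv/= => -[/andP[ux _] /andP[_ xv]].
    by move: ux xv vu; lra.
  apply/trivIsetP => i j _ _; rewrite neq_ltn => /orP[/lt_disj//|/lt_disj].
  by rewrite setIC.
rewrite (big_nth (0, 0)) big_mkord; apply: (acd _ u v).
- move=> i; have [h1 h2 h3 _] := sP _ (inS i).
  split => //=; rewrite in_itv/=; apply/andP; split.
  + exact: lt_le_trans h1.
  + by rewrite (lt_le_trans h2)// (le_trans h3)// ltW.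
  + by rewrite (lt_le_trans la)// (le_trans h1)// ltW.
  + exact: le_lt_trans br.
- exact: tuv.
- rewrite -lte_fin; apply: le_lt_trans Ud; apply: sum_length_le => //.
  + by move=> i; have [] := sP _ (inS i).
  + by move=> i; have [] := sP _ (inS i).
Qed.

Lemma absolutely_continuous_derive0 (l r a b : R) (G : R -> R) :
  absolutely_continuous `]l, r[ G ->
  {ae mu, forall t, t \in `]l, r[ -> derivable G t 1 /\ derive1 G t = 0} ->
  l < a -> a <= b -> b < r -> G a = G b.
Proof.
move=> acG dG la ab br; apply/eqP; rewrite eq_sym -subr_eq0 -normr_le0.
apply/ler_addgt0Pl => e e0; rewrite addr0.
have c0 : 0 < b - a + 1 by rewrite ltr_wpDl ?subr_ge0.
have := absolutely_continuous_derive0_le l r a b G (e / (b - a + 1)) acG dG la ab br.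
rewrite divr_gt0// => /(_ isT) /le_trans; apply.
by rewrite -[X in _ + X]mulr1 -mulrDr divfK ?gt_eqF.
Qed.

End absolutely_continuous_const.

(** * Primitives of integrable functions *)

Section primitive.
Context {R : realType}.
Local Notation mu := (@lebesgue_measure R).
Variable h : R -> R.
Hypothesis ih : mu.-integrable setT (EFin \o h).

Let H t := \int[mu]_(s in `]0, t[) h s.

Let ihA (A : set R) : measurable A -> mu.-integrable A (EFin \o h).
Proof. by move=> mA; apply: integrableS ih. Qed.

Let HE : H = fun t => \int[mu]_(s in `]0, t]) h s.
Proof.
apply/funext => t; rewrite /H Rintegral_itv_bndo_bndc//.
exact: ihA.
Qed.

Lemma primitive_derive :
  {ae mu, forall t, 0 < t -> derivable H t 1 /\ derive1 H t = h t}.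
Proof.
have loc : locally_integrable setT h.
  by have := integrable_locally measurableT ih; rewrite patch_setT.
have := @FTC1 _ h (BRight 0) (fun y => ihA _ (measurable_itv _)) loc.
rewrite /= -HE; apply: filterS; first exact: (ae_filter_ringOfSetsType mu).
by move=> t Ht t0; apply: Ht; rewrite lte_fin.
Qed.

Lemma primitiveB (a b : R) : 0 <= a -> a < b ->
  H b - H a = \int[mu]_(s in `]a, b[) h s.
Proof.
move=> a0 ab; have l1 : (BRight 0 <= BRight a)%O by rewrite bnd_simp.
have l2 : (BRight a <= BRight b)%O by rewrite bnd_simp ltW.
rewrite HE (Rintegral_itvB (ihA _ (measurable_itv _)) l1 l2).
by rewrite Rintegral_itv_bndo_bndc//; exact: ihA.
Qed.

Lemma primitive_ac (d : R) : absolutely_continuous `]0, d[ H.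
Proof.
move=> e e0; have [d0 [d0gt acd]] := integral_normr_continuous ih e0.
exists d0 => // n a b ab tab sab.
pose r := index_enum ('I_n : finType).
have ur : uniq r by exact: index_enum_uniq.
pose A := \big[setU/set0]_(i \in [set` r]) `]a i, b i[%classic.
have mA : measurable A.
  rewrite /A fsbig_setU//.
  by apply: fin_bigcup_measurable => // i _; exact: measurable_itv.
have AE : A = \big[setU/set0]_(i <- r) `]a i, b i[%classic by rewrite /A -fsbig_seq.
have muA : (mu A < d0%:E)%E.
  apply: le_lt_trans; last by rewrite -lte_fin in sab; exact: sab.
  rewrite /A measure_fsbig//=; last exact: sub_trivIset tab.
  rewrite -fsbig_seq// -sumEFin; apply: lee_sum => i _.
  by have [_ _ abi] := ab i; rewrite lebesgue_measure_itv/= lte_fin abi -EFinB.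
apply: le_lt_trans (acd A mA muA).
have iA (B : set R) : measurable B -> (\int[mu]_(x in B) `|(h x)%:E|)%E \is a fin_num.
  move=> mB; have /integrableP[_ hoo] := ihA B mB.
  by rewrite ge0_fin_numE// integral_ge0.
rewrite -lee_fin /Rintegral fineK; last exact: iA.
rewrite AE ge0_integral_bigsetU//=; last 2 first.
- exact: sub_trivIset tab.
- rewrite -AE; do 2 apply: measurableT_comp => //; apply/measurable_EFinP.
  exact: measurable_int (ihA A mA).
rewrite -sumEFin; apply: lee_sum => i _.
have [ai _ abi] := ab i; move: ai; rewrite /= in_itv/= => /andP[ai _].
rewrite primitiveB ?(ltW ai)//.
rewrite -abse_EFin /Rintegral fineK; last first.
  by apply: integrable_fin_num => //; exact: ihA.
by apply: le_abse_integral => //; exact: measurable_int (ihA _ (measurable_itv _)).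
Qed.

Lemma primitive_cvg0 : H t @[t --> 0^'+] --> (0 : R).
Proof.
apply/cvgrPdist_lt => e e0.
have [d0 [d0gt acd]] := integral_normr_continuous ih e0.
near=> t; have t0 : 0 < t by near: t; exact: nbhs_right_gt.
have mt : (mu `]0%R, t[%classic < d0%:E)%E.
  rewrite lebesgue_measure_itv/= lte_fin t0 oppr0 adde0 lte_fin.
  by near: t; exact: nbhs_right_lt.
rewrite sub0r normrN; apply: le_lt_trans (acd _ (measurable_itv _) mt).
by apply: le_normr_Rintegral => //; exact: ihA.
Unshelve. all: by end_near. Qed.

End primitive.

Section primitive_zero.
Context {R : realType}.
Local Notation mu := (@lebesgue_measure R).

Lemma derive1_congr_itv (d t : R) (G H : R -> R) : t \in `]0, d[ ->
  (forall s, s \in `]0, d[ -> G s = H s) ->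
  (derivable G t 1 -> derivable H t 1) /\ derive1 G t = derive1 H t.
Proof.
move=> td GH.
have near_GH : \forall s \near t, G s = H s.
  by near=> s; apply: GH; near: s; exact: near_in_itvoo.
split; first by apply: near_eq_derivable.
by rewrite !derive1E; exact: near_eq_derive.
Unshelve. all: by end_near. Qed.

Lemma primitive_eq0_ae (h : R -> R) (d : R) : mu.-integrable setT (EFin \o h) ->
  (forall t, t \in `]0, d[ -> \int[mu]_(s in `]0, t[) h s = 0) ->
  ae_eq mu `]0, d[%classic h (cst 0).
Proof.
move=> ih h0; have := primitive_derive h ih.
apply: filterS; first exact: (ae_filter_ringOfSetsType mu).
move=> t ht td.
have t0 : 0 < t by move: td; rewrite /= in_itv/= => /andP[].
have [_ <-] := ht t0.
rewrite (derive1_congr_itv d t _ (cst 0) td h0).2.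
by rewrite derive1_cst.
Qed.

End primitive_zero.

(** * The Cauchy problem and the integral equation *)

Section cauchy_fixed_point.
Context {R : realType}.
Local Notation mu := (@lebesgue_measure R).

Lemma absolutely_continuousB (D : set R) (G H : R -> R) :
  absolutely_continuous D G -> absolutely_continuous D H ->
  absolutely_continuous D (G \- H).
Proof.
move=> acG acH e e0; have e2 : 0 < e / 2 by rewrite divr_gt0.
have [d1 d10 H1] := acG _ e2; have [d2 d20 H2] := acH _ e2.
exists (Num.min d1 d2) => [|n a b abD tab]; first by rewrite lt_min d10.
rewrite lt_min => /andP[/(H1 n a b abD tab) h1 /(H2 n a b abD tab) h2].
rewrite [e]splitr; apply: le_lt_trans (ltrD h1 h2).
rewrite -big_split/=; apply: ler_sum => i _.
have -> : G (b i) - H (b i) - (G (a i) - H (a i)) =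
  (G (b i) - G (a i)) - (H (b i) - H (a i)) by ring.
exact: ler_normB.
Qed.

Lemma absolutely_continuous_congr (D : set R) (G H : R -> R) :
  (forall x, D x -> G x = H x) ->
  absolutely_continuous D G -> absolutely_continuous D H.
Proof.
move=> GH acG e e0; have [d d0 Hd] := acG _ e0; exists d => // n a b abD tab sab.
have -> : \sum_(i < n) `|H (b i) - H (a i)| = \sum_(i < n) `|G (b i) - G (a i)|.
  by apply: eq_bigr => i _; have [Da Db _] := abD i; rewrite !GH.
exact: Hd.
Qed.

Lemma cvg_right_congr (d : R) (G H : R -> R) : 0 < d ->
  (forall x, x \in `]0, d[ -> G x = H x) ->
  G t @[t --> 0^'+] --> (0 : R) -> H t @[t --> 0^'+] --> (0 : R).
Proof.
move=> d0 GH; apply: cvg_trans; apply: near_eq_cvg; near=> t.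
rewrite GH// in_itv/=; apply/andP; split; near: t; first exact: nbhs_right_gt.
exact: nbhs_right_lt.
Unshelve. all: by end_near. Qed.

Lemma RL_integral_congr (a d t : R) (g h : R -> R) : t <= d ->
  (forall s, s \in `]0, d[ -> g s = h s) -> RL_integral a g t = RL_integral a h t.
Proof.
move=> td gh; apply: (RL_integral_congr_ae a d) => //.
exact/aeW.
Qed.

Variables (alpha d : R) (f : R -> R -> R).
Hypotheses (alpha0 : 0 < alpha) (alpha1 : alpha < 1) (d0 : 0 < d).

Let onem_alpha : 1 - (1 - alpha) = alpha. Proof. by ring. Qed.

(** Apply the fractional integral of order [1 - alpha] to the integral
    equation. *)
Lemma RL_integral_fixed (u h : R -> R) : mu.-integrable setT (EFin \o h) ->
  (forall t, t \in `]0, d[ -> u t = RL_integral alpha h t) ->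
  forall t, t <= d -> RL_integral (1 - alpha) u t = \int[mu]_(s in `]0, t[) h s.
Proof.
move=> ih uh t td; rewrite (RL_integral_congr _ d t u _ td uh).
rewrite -[in RL_integral alpha h]onem_alpha RL_integral_compl ?subr_gt0//.
by rewrite gtrBl.
Qed.

(** A solution of the integral equation has the primitive of the right-hand side
    as its fractional integral of order [1 - alpha]; Lebesgue's differentiation
    theorem gives the differential equation. *)
Lemma fixed_cauchy_solution (u h : R -> R) : mu.-integrable setT (EFin \o h) ->
  ae_eq mu `]0, d[%classic (nemytskii f u) h ->
  (forall t, t \in `]0, d[ -> u t = RL_integral alpha h t) ->
  cauchy_solution alpha d f u.
Proof.
move=> ih fuh uh.
have JE t : t \in `]0, d[ ->
    \int[mu]_(s in `]0, t[) h s = RL_integral (1 - alpha) u t.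
  by rewrite in_itv/= => /andP[_ td]; rewrite (RL_integral_fixed u h)// ltW.
split.
- apply: absolutely_continuous_congr (primitive_ac h ih d) => t.
  exact: JE.
- have := primitive_derive h ih; move: fuh.
  apply: filterS2.
  move=> t fut dt td; have t0 : 0 < t by move: td; rewrite in_itv/= => /andP[].
  have [dH H'] := dt t0; have [h1 h2] := derive1_congr_itv d t _ _ td JE.
  split; first exact: h1.
  by rewrite /RL_derivative -h2 H' -fut.
- exact: cvg_right_congr d0 JE (primitive_cvg0 h ih).
Qed.

(** For a solution [v] of the Cauchy problem, the fractional integral of order
    [1 - alpha] of [v] and the primitive of the right-hand side are absolutely
    continuous with the same derivative and the same limit at zero, hence equal.
    The fractional integral of order [alpha] turns this equality into that of the
    primitives of [v] and of [w]. *)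
Lemma cauchy_solution_fixed (v g h w : R -> R) :
  mu.-integrable setT (EFin \o g) -> mu.-integrable setT (EFin \o h) ->
  mu.-integrable setT (EFin \o w) ->
  ae_eq mu `]0, d[%classic v g ->
  ae_eq mu `]0, d[%classic (nemytskii f v) h ->
  (forall t, t \in `]0, d[ -> w t = RL_integral alpha h t) ->
  cauchy_solution alpha d f v -> ae_eq mu `]0, d[%classic v w.
Proof.
move=> ig ih iw vg fvh wh [acJ dJ J0].
pose J := RL_integral (1 - alpha) v; pose H t := \int[mu]_(s in `]0, t[) h s.
pose G := J \- H.
have acG : absolutely_continuous `]0, d[ G.
  by apply: absolutely_continuousB => //; exact: primitive_ac.
have dG : {ae mu, forall t, t \in `]0, d[ -> derivable G t 1 /\ derive1 G t = 0}.
  have dH := primitive_derive h ih; move: fvh dJ dH.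
  apply: filterS3.
  move=> t fvt dJt dHt td; have t0 : 0 < t by move: td; rewrite in_itv/= => /andP[].
  have [dJ1 dJ2] := dJt td; have [dH1 dH2] := dHt t0.
  change (derivable (J - H) t 1 /\ derive1 (J - H) t = 0).
  split; first exact: (derivableB dJ1 dH1).
  rewrite derive1E (deriveB dJ1 dH1) -!derive1E -/(RL_derivative alpha v t).
  by rewrite dJ2 dH2 -fvt// subrr.
have G0 : G t @[t --> 0^'+] --> (0 : R).
  by rewrite -[X in _ --> X]subr0; apply: cvgB => //; exact: primitive_cvg0.
have JH t : t \in `]0, d[ -> J t = H t.
  rewrite in_itv/= => /andP[t0 td]; apply/eqP; rewrite -subr_eq0; apply/eqP.
  have : G s @[s --> 0^'+] --> G t.
    apply: (@cvg_trans _ (G t @[_ --> (0 : R)^'+])); last exact: cvg_cst.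
    apply: near_eq_cvg; near=> s.
    have s0 : 0 < s by near: s; exact: nbhs_right_gt.
    have st : s <= t by near: s; exact: nbhs_right_le.
    by rewrite (absolutely_continuous_derive0 0 d s t G).
  by move=> /cvg_unique; apply.
have ext t : t \in `]0, d[ ->
    \int[mu]_(s in `]0, t[) g s = \int[mu]_(s in `]0, t[) w s.
  rewrite in_itv/= => /andP[t0 td].
  rewrite -(RL_integral_compl alpha t g alpha0 alpha1 ig).
  rewrite -(RL_integral_compl alpha t w alpha0 alpha1 iw).
  apply: (RL_integral_congr alpha d); first exact: ltW.
  move=> s sd; have sd' : s <= d by move: sd; rewrite in_itv/= => /andP[_ /ltW].
  transitivity (J s).
    by rewrite /J (RL_integral_congr_ae (1 - alpha) d s v g).
  rewrite JH// /H -(RL_integral_fixed w h ih wh)//.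
have igw : mu.-integrable setT (EFin \o (g \- w)).
  have -> : EFin \o (g \- w) = ((EFin \o g) \- (EFin \o w))%E by [].
  exact: integrableB.
have := primitive_eq0_ae (g \- w) d igw; move=> gw.
have {}gw : ae_eq mu `]0, d[%classic (g \- w) (cst 0).
  apply: gw => t td; rewrite RintegralB//; last 2 first.
  - by apply: integrableS ig.
  - by apply: integrableS iw.
  by rewrite ext// subrr.
move: vg gw; apply: filterS2.
by move=> t vg gw td; rewrite vg//; apply: subr0_eq; exact: gw.
Unshelve. all: by end_near. Qed.

End cauchy_fixed_point.

(** * Fixed points of Volterra operators *)

Section volterra.
Context {R : realType}.

(** A cluster point along an ultrafilter is a limit: one of the two preimages of a
    ball and of its complement is large. *)
Lemma ultra_bounded_lim (U : set_system nat) (x : nat -> R) (M : R) :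
  UltraFilter U -> (forall m, `|x m| <= M) ->
  exists c, `|c| <= M /\ forall e, 0 < e -> U [set m | `|x m - c| < e].
Proof.
move=> ultraU xM.
have UM : (x @ U) `[- M, M]%classic.
  rewrite /fmap /=; apply: filterE => m.
  by rewrite /= in_itv/= -ler_norml; exact: xM.
have [c [cM Uc]] := @segment_compact R (- M) M (x @ U) _ UM.
exists c; split; first by move: cM; rewrite /= in_itv/= -ler_norml.
move=> e e0; have [//|UC] := in_ultra_setVsetC [set m | `|x m - c| < e] ultraU.
have UB : (x @ U) (~` ball c e).
  change (U (x @^-1` (~` ball c e))).
  by apply: filterS UC => m h xm; apply: h; rewrite /= distrC.
by have [y [yB yb]] := Uc _ _ UB (nbhsx_ballx c e e0).
Qed.

Lemma powR_small (L k e : R) : 0 <= L -> 0 < k -> 0 < e ->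
  exists2 r, 0 < r & forall h, 0 <= h -> h <= r -> L * h `^ k <= e.
Proof.
move=> L0 k0 e0; have L1 : 0 < L + 1 by rewrite ltr_wpDl.
pose r := (e / (L + 1)) `^ k^-1.
exists r => [|h h0 hr]; first by rewrite powR_gt0// divr_gt0.
apply: (@le_trans _ _ (L * r `^ k)).
  by rewrite ler_wpM2l// ge0_ler_powR ?nnegrE ?powR_ge0// ltW.
rewrite /r -powRrM mulVf ?gt_eqF// powRr1 ?divr_ge0 ?(ltW e0) ?(ltW L1)//.
rewrite mulrA ler_pdivrMr// [leRHS]mulrC ler_wpM2r ?(ltW e0)//.
by rewrite lerDl.
Qed.

Variable d : R.

Definition cut_itv (g : R -> R) (t : R) : R := if t \in `]0, d[ then g t else 0.

Lemma cut_itvE g t : t \in `]0, d[ -> cut_itv g t = g t.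
Proof. by rewrite /cut_itv => ->. Qed.

Definition unit_ball_itv : set (R -> R) := [set u : R -> R |
  [/\ measurable_fun setT u, forall t, `|u t| <= 1 &
      forall t, t \notin `]0, d[ -> u t = 0]].

Variables (L k : R) (L0 : 0 <= L) (k0 : 0 < k).

Definition holder_itv (u : R -> R) := forall s t, 0 < s -> s <= t -> t < d ->
  `|u t - u s| <= L * (t - s) `^ k.

Lemma holder_itv_measurable (u : R -> R) : holder_itv u -> measurable_fun setT (cut_itv u).
Proof.
move=> hu; have mu : measurable_fun `]0, d[%classic u.
  apply: open_continuous_measurable_fun; first exact: interval_open.
  move=> x; rewrite inE/= in_itv/= => /andP[x0 xd].
  apply/cvgrPdist_le => e e0.
  have [r r0 Hr] := powR_small L k e L0 k0 e0.
  near=> y.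
  have y0 : 0 < y by near: y; exact: lt_nbhsr.
  have yd : y < d by near: y; exact: lt_nbhsl.
  have : `|x - y| <= r.
    by apply: ltW; near: y; exact: (nbhsx_ballx x r r0).
  have [xy|/ltW yx] := leP x y => xyr.
    apply: (@le_trans _ _ (L * (y - x) `^ k)); first by rewrite distrC hu.
    by apply: Hr; [rewrite subr_ge0|rewrite -(ger0_norm (_ : 0 <= y - x)) ?subr_ge0// distrC].
  apply: (@le_trans _ _ (L * (x - y) `^ k)); first by rewrite hu.
  by apply: Hr; [rewrite subr_ge0|rewrite -(ger0_norm (_ : 0 <= x - y)) ?subr_ge0].
have -> : cut_itv u = u \_ `]0, d[%classic.
  by apply/funext => t; rewrite patchE /cut_itv mem_setE.
exact/(measurable_restrictT _ _).1.
Unshelve. all: by end_near. Qed.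

End volterra.

Section volterra_fixed_point.
Context {R : realType}.
Variables (d L k : R).
Hypotheses (d0 : 0 < d) (L0 : 0 <= L) (k0 : 0 < k) (Ld : L * d `^ k <= 1).
Variable T : (R -> R) -> R -> R.
Hypothesis T_holder : forall u, unit_ball_itv d u -> forall s t,
  0 <= s -> s <= t -> t <= d -> `|T u t - T u s| <= L * (t - s) `^ k.
Hypothesis T_le0 : forall u t, t <= 0 -> T u t = 0.
Hypothesis T_volterra : forall u v t,
  (forall s, 0 < s -> s < t -> u s = v s) -> T u t = T v t.
Hypothesis T_continuous : forall u, unit_ball_itv d u -> forall e, 0 < e ->
  exists2 r, 0 < r & forall v, unit_ball_itv d v ->
    (forall t, `|v t - u t| <= r) ->
    forall t, 0 <= t -> t <= d -> `|T v t - T u t| <= e.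

Let T_holderW u : unit_ball_itv d u -> forall s t, s <= t -> t <= d ->
  `|T u t - T u s| <= L * (t - s) `^ k.
Proof.
move=> Bu s t st td; have [s0|s0] := leP 0 s; first exact: T_holder.
rewrite (T_le0 u s) ?(ltW s0)// subr0; have [t0|t0] := leP t 0.
  by rewrite T_le0// normr0 mulr_ge0 ?powR_ge0.
apply: (@le_trans _ _ (L * (t - 0) `^ k)).
  have := T_holder u Bu 0 t (lexx _) (ltW t0) td.
  by rewrite (T_le0 u 0)// subr0.
rewrite ler_wpM2l// ge0_ler_powR ?nnegrE ?(ltW k0) ?subr0 ?(ltW t0)//.
  by rewrite subr_ge0 (le_trans (ltW s0) (ltW t0)).
by rewrite lerDl oppr_ge0 ltW.
Qed.

Let unit_ball_cut (u : R -> R) : holder_itv d L k u ->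
  (forall t, 0 < t -> t < d -> `|u t| <= 1) -> unit_ball_itv d (cut_itv d u).
Proof.
move=> hu u1; split; first exact: (holder_itv_measurable d L k).
- move=> t; rewrite /cut_itv; case: ifPn => [|_]; last by rewrite normr0.
  by rewrite in_itv/= => /andP[t0 td]; exact: u1.
- by move=> t; rewrite /cut_itv => /negbTE ->.
Qed.

Let delay r v := cut_itv d (fun t => T v (t - r)).

Let delay_holder r v : 0 <= r -> unit_ball_itv d v ->
  holder_itv d L k (fun t => T v (t - r)).
Proof.
move=> r0 Bv s t s0 st td; have -> : t - s = (t - r) - (s - r) by ring.
apply: T_holderW => //; first by rewrite lerB.
by rewrite (le_trans _ (ltW td))// gerBl.
Qed.

Let delay_ball r v : 0 <= r -> unit_ball_itv d v -> unit_ball_itv d (delay r v).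
Proof.
move=> r0 Bv; apply: unit_ball_cut; first exact: delay_holder.
move=> t t0 td; have [tr|tr] := leP (t - r) 0; first by rewrite T_le0// normr0.
have trd : t - r <= d by rewrite (le_trans _ (ltW td))// gerBl.
have := T_holder v Bv 0 (t - r) (lexx _) (ltW tr) trd.
rewrite (T_le0 v 0)// !subr0 => /le_trans; apply; apply: le_trans Ld.
by rewrite ler_wpM2l// ge0_ler_powR ?nnegrE ?(ltW k0) ?(ltW tr) ?(ltW d0).
Qed.

Let zero_ball : unit_ball_itv d (cst 0 : R -> R).
Proof. by split => // t; rewrite normr0. Qed.

(** The equation with delay [r] is solved by iteration, since the values on
    [(0, n r)] are final after [n] steps. *)
Lemma delayed_fixed_point (r : R) : 0 < r ->
  exists2 v, unit_ball_itv d v & forall t, 0 < t -> t < d -> v t = T v (t - r).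
Proof.
move=> r0; pose v n := iter n (delay r) (cst 0).
have Bv n : unit_ball_itv d (v n).
  by elim: n => [|n IH]; [exact: zero_ball|exact: delay_ball (ltW r0) IH].
have stable n t : t <= n%:R * r -> v n.+1 t = v n t.
  elim: n t => [|n IH] t.
    rewrite mul0r => t0; rewrite /v /= /delay /cut_itv; case: ifPn => //.
    by rewrite in_itv/= => /andP[/(le_lt_trans t0)]; rewrite ltxx.
  move=> tn; change (delay r (v n.+1) t = delay r (v n) t); rewrite /delay /cut_itv.
  case: ifPn => // _; apply: T_volterra => s s0 st; apply: IH.
  rewrite (le_trans (ltW st))// lerBlDr (le_trans tn)//.
  by rewrite -natr1 mulrDl mul1r.
pose n := (Num.truncn (d / r)).+1.
exists (v n) => // t t0 td.
rewrite -stable; last first.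
  by rewrite (le_trans (ltW td))// -ler_pdivrMr// ltW// truncnS_gt.
by change (delay r (v n) t = T (v n) (t - r)); rewrite /delay cut_itvE// in_itv/= t0.
Qed.

(** Tonelli's method, which replaces Schauder's fixed point theorem for Volterra
    operators: the solutions of the equations with delay [1 / m.+1] are uniformly
    bounded and equicontinuous, so their pointwise limit along an ultrafilter is
    a uniform limit, and continuity of [T] passes to the limit. *)
Lemma volterra_fixed_point :
  exists2 u, unit_ball_itv d u & forall t, 0 < t -> t < d -> u t = T u t.
Proof.
pose r m : R := m.+1%:R^-1.
have r_gt0 m : 0 < r m by rewrite invr_gt0.
have /choice[v Hv] : forall m, exists v, unit_ball_itv d v /\
    forall t, 0 < t -> t < d -> v t = T v (t - r m).
  by move=> m; have [v] := delayed_fixed_point (r m) (r_gt0 m); exists v.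
have Bv m := (Hv m).1; have vE m := (Hv m).2.
have [U [ultraU ooU]] := ultraFilterLemma (F := \oo) _.
have v1 t m : `|v m t| <= 1 by have [_ h _] := Bv m.
have /choice[u uP] : forall t, exists c, `|c| <= 1 /\
    forall e, 0 < e -> U [set m | `|v m t - c| < e].
  by move=> t; exact: ultra_bounded_lim (v1 t).
have u1 t : `|u t| <= 1 := (uP t).1.
have u_lim t e : 0 < e -> U [set m | `|v m t - u t| < e] := (uP t).2 e.
have hv m : holder_itv d L k (v m).
  move=> s t s0 st td.
  rewrite !vE//; last 2 first.
  - exact: le_lt_trans td.
  - exact: lt_le_trans st.
  exact: (delay_holder (r m) (v m) (ltW (r_gt0 m)) (Bv m)).
have hu : holder_itv d L k u.
  move=> s t s0 st td; apply/ler_addgt0Pl => e e0.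
  have e2 : 0 < e / 2 by rewrite divr_gt0.
  have [m [/= ms mt]] : [set m | `|v m s - u s| < e / 2] `&`
      [set m | `|v m t - u t| < e / 2] !=set0.
    by apply: (@filter_ex _ U); apply: filterI; apply: u_lim.
  have := ler_distD (v m t) (u t) (u s); have := ler_distD (v m s) (v m t) (u s).
  have := hv m s t s0 st td; move: ms mt; rewrite [`|u t - v m t|]distrC.
  by lra.
have uE t : t \notin `]0, d[ -> u t = 0.
  move=> td; apply/eqP; rewrite -normr_le0; apply/ler_addgt0Pl => e e0.
  have [m /= mt] := filter_ex (u_lim t e e0); rewrite addr0 ltW//.
  by move: mt; have [_ _ ->//] := Bv m; rewrite sub0r normrN.
have Bu : unit_ball_itv d u.
  have -> : u = cut_itv d u.
    by apply/funext => t; rewrite /cut_itv; case: ifPn => // /uE.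
  by apply: unit_ball_cut => // t _ _; exact: u1.
(* Pointwise convergence on a grid that is fine compared with the common modulus
   of continuity is uniform convergence. *)
have u_unif e : 0 < e -> U [set m | forall t, `|v m t - u t| <= e].
  move=> e0; have e3 : 0 < e / 3 by rewrite divr_gt0.
  have [rho rho0 Hrho] := powR_small L k _ L0 k0 e3.
  pose N := (Num.truncn (d / rho)).+1.
  pose h := d / N.+1%:R.
  have h0 : 0 < h by rewrite divr_gt0.
  have Nh : N.+1%:R * h = d by rewrite /h mulrC divfK.
  have hrho : h <= rho.
    rewrite /h ler_pdivrMr// mulrC -ler_pdivrMr// ltW//.
    by rewrite (lt_trans (truncnS_gt _))// ltr_nat.
  pose x (i : 'I_N) : R := i.+1%:R * h.
  have x0 i : 0 < x i by rewrite mulr_gt0.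
  have xd i : x i < d by rewrite -Nh ltr_pM2r// ltr_nat ltnS.
  have : U [set m | forall i : 'I_N, `|v m (x i) - u (x i)| < e / 3].
    by apply: filter_forall => i; apply: u_lim.
  apply: filterS => m /= Hm t.
  have [td|td] := boolP (t \in `]0, d[); last first.
    by rewrite uE//; have [_ _ ->//] := Bv m; rewrite subr0 normr0 ltW.
  move: td; rewrite in_itv/= => /andP[t0 td].
  have [i ti] : exists i : 'I_N, `|t - x i| <= h.
    pose j := Num.truncn (t / h).
    have th0 : 0 <= t / h by rewrite divr_ge0// ltW.
    have jt : j%:R * h <= t by rewrite -ler_pdivlMr// truncn_le.
    have tj : t < j.+1%:R * h by rewrite -ltr_pdivrMr// truncnS_gt.
    have jN : (j < N.+1)%N by rewrite -(ltr_nat R) -(ltr_pM2r h0) (le_lt_trans jt)// Nh.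
    (* before the first grid point, that point is the nearest one *)
    case: j jt tj jN => [|j] jt tj jN.
      exists ord0; rewrite /x mul1r distrC ger0_norm; first by rewrite gerBl ltW.
      by rewrite subr_ge0 ltW// -[h]mul1r.
    exists (Ordinal (jN : (j < N)%N)); rewrite /x /= ger0_norm ?subr_ge0//.
    by rewrite lerBlDl ltW// -[X in _ < _ + X]mul1r -mulrDl natr1.
  have close w : holder_itv d L k w -> `|w t - w (x i)| <= e / 3.
    move=> hw; have [tx|/ltW xt] := leP t (x i).
      rewrite distrC; apply: le_trans (hw t (x i) t0 tx (xd i)) _.
      apply: Hrho; rewrite ?subr_ge0//; apply: le_trans hrho; apply: le_trans ti.
      by rewrite distrC ler_norm.
    apply: le_trans (hw (x i) t (x0 i) xt td) _.
    apply: Hrho; rewrite ?subr_ge0//; apply: le_trans hrho; apply: le_trans ti.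
    exact: ler_norm.
  have := close _ hu; have := close _ (hv m); have := Hm i.
  have := ler_distD (v m (x i)) (v m t) (u t).
  have := ler_distD (u (x i)) (v m (x i)) (u t).
  rewrite [`|u (x i) - u t|]distrC; lra.
exists u => // t t0 td; apply/eqP; rewrite -subr_eq0 -normr_le0.
apply/ler_addgt0Pl => e e0; have e3 : 0 < e / 3 by rewrite divr_gt0.
have [rho rho0 Hrho] := T_continuous u Bu _ e3.
have [rh rh0 Hrh] := powR_small L k _ L0 k0 e3.
have Ur : U [set m | r m <= rh].
  apply: ooU; exists (Num.truncn rh^-1) => // m /= hm.
  rewrite /r invf_ple ?posrE// (le_trans (ltW (truncnS_gt _)))// ler_nat.
  by rewrite ltnS.
have [m [/= [m1 m2] m3]] : ([set m | `|v m t - u t| < e / 3] `&`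
    [set m | r m <= rh]) `&` [set m | forall s, `|v m s - u s| <= rho] !=set0.
  apply: (@filter_ex _ U); apply: filterI; last exact: u_unif.
  by apply: filterI => //; apply: u_lim.
have m4 := Hrho _ (Bv m) m3 t (ltW t0) (ltW td).
have m5 : `|T (v m) t - T (v m) (t - r m)| <= e / 3.
  apply: le_trans (T_holderW (v m) (Bv m) (t - r m) t _ (ltW td)) _.
    by rewrite gerBl ltW.
  have -> : t - (t - r m) = r m by ring.
  by apply: Hrh => //; rewrite ltW.
move: m5; rewrite -vE// => m5.
have := ler_distD (v m t) (u t) (T u t); have := ler_distD (T (v m) t) (v m t) (T u t).
by move: m1 m4 m5; rewrite [`|u t - v m t|]distrC [`|T (v m) t - v m t|]distrC; lra.
Qed.

End volterra_fixed_point.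

(** * One-sided weights *)

Section weights.
Context {R : realType}.
Local Notation mu := (@lebesgue_measure R).

(** The representative is positive outside a null set, on which it can be replaced
    by [1]. *)
Lemma weight_rep (w : R -> R) : weight w -> exists w' : R -> R,
  [/\ measurable_fun setT w', forall x, 0 < w' x & ae_eq mu setT w w'].
Proof.
move=> [w0 [h mh wh]]; exists (fun x => if 0 < h x then h x else 1); split.
- by apply: measurable_fun_ifT => //; exact: measurable_fun_ltr.
- by move=> x; case: ifPn.
- by apply: filterS wh => x wh _; rewrite -(wh I) w0.
Qed.

Lemma integral_weight_rep (w w' : R -> R) (D : set R) (e : R) :
  ae_eq mu setT w w' ->
  (\int[mu]_(x in D) (w x `^ e)%:E = \int[mu]_(x in D) (w' x `^ e)%:E)%E.
Proof.
move=> ww'; apply: integral_congr_ae.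
by apply: filterS ww' => x ww' _; rewrite ww'.
Qed.

Lemma integral_itv_gt0 (f : R -> R) (a b : R) : measurable_fun setT f ->
  (forall x, 0 < f x) -> a < b -> (0 < \int[mu]_(x in `]a, b[) (f x)%:E)%E.
Proof.
move=> mf f0 ab; have int0 : (0 <= \int[mu]_(x in `]a, b[) (f x)%:E)%E.
  by apply: integral_ge0 => x _; rewrite lee_fin ltW.
rewrite lt_neqAle int0 andbT eq_sym; apply/eqP => int_eq0.
have mfab : measurable_fun `]a, b[%classic (EFin \o f).
  by apply/measurable_EFinP; exact: measurable_funTS.
have : (\int[mu]_(x in `]a, b[) `|(EFin \o f) x| = 0)%E.
  by rewrite -[RHS]int_eq0; apply: eq_integral => x _; rewrite gee0_abs// lee_fin ltW.
move=> /(ae_eq_integral_abs mu (measurable_itv _) mfab) [N [mN N0 abN]].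
have abN' : `]a, b[%classic `<=` N.
  move=> x xab; apply: abN => /= /(_ xab) [fx]; by have := f0 x; rewrite fx ltxx.
have : (mu `]a, b[%classic <= mu N)%E.
  by apply: le_measure; rewrite ?inE.
have -> : mu N = 0%E by exact: N0.
by rewrite lebesgue_measure_itv/= lte_fin ab -EFinB lee_fin subr_le0 leNgt ab.
Qed.

Lemma integral_weight_gt0 (w : R -> R) (a b e : R) : weight w -> a < b ->
  (0 < \int[mu]_(x in `]a, b[) (w x `^ e)%:E)%E.
Proof.
move=> /weight_rep[w' [mw' w'0 ww']] ab; rewrite (integral_weight_rep w w' _ _ ww').
apply: integral_itv_gt0 => // [|x]; last exact: powR_gt0.
by apply: (@measurableT_comp _ _ _ _ _ _ (@powR R ^~ e)) => //; exact: measurable_powR.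
Qed.

(** The two factors of the weight condition are positive, so that neither of them
    can be infinite. *)
Lemma Aplus_loc_integrable (p q sigma : R) (w : R -> R) : 1 < p -> 1 < q ->
  Aplus p q sigma w -> forall a b, a < b ->
  ((\int[mu]_(x in `]a, b[) (w x `^ q)%:E < +oo)%E /\
   (\int[mu]_(x in `]a, b[) (w x `^ (- conj_exponent p))%:E < +oo)%E).
Proof.
move=> p1 q1 [ww [C HC]] a b ab.
have p'0 : 0 < conj_exponent p.
  by rewrite divr_gt0 ?subr_gt0// (lt_trans _ p1).
have q0 : 0 < q by exact: lt_trans q1.
have k0 (x y : R) : x < y -> (0 < ((y - x) `^ (1 - sigma))^-1%:E)%E.
  by move=> xy; rewrite lte_fin invr_gt0 powR_gt0// subr_gt0.
split; rewrite ltey; apply/eqP => oo.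
- have := HC a b (b + 1) ab; rewrite ltrDl ltr01 => /(_ isT).
  rewrite oo poweRyr ?gt_eqF ?invr_gt0// gt0_muley ?k0//; last first.
    by rewrite (lt_trans ab)// ltrDl.
  rewrite gt0_mulye ?poweR_gt0//; last by rewrite integral_weight_gt0// ltrDl.
- have := HC (a - 1) a b _ ab; rewrite ltrBlDr ltrDl ltr01 => /(_ isT).
  rewrite oo poweRyr ?gt_eqF ?invr_gt0// gt0_muley//.
  rewrite mule_gt0//; first by rewrite k0// ltrBlDr (lt_trans ab)// ltrDl.
  by rewrite poweR_gt0// integral_weight_gt0// ltrBlDr ltrDl.
Qed.

Lemma powR_le1D (x s r : R) : 0 < x -> 0 <= s -> s <= r -> x `^ s <= 1 + x `^ r.
Proof.
move=> x0 s0 sr; have [x1|x1] := leP 1 x.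
  by rewrite (le_trans (ler_powR x1 sr))// lerDr.
apply: (@le_trans _ _ 1); last by rewrite lerDl powR_ge0.
by rewrite -(powRr0 x) ger_powR// x0/= ltW.
Qed.

Lemma integral_powR_le (w : R -> R) (a b s r : R) : weight w -> a < b ->
  0 <= s -> s <= r -> (\int[mu]_(x in `]a, b[) (w x `^ r)%:E < +oo)%E ->
  (\int[mu]_(x in `]a, b[) (w x `^ s)%:E < +oo)%E.
Proof.
move=> /weight_rep[w' [mw' w'0 ww']] ab s0 sr.
rewrite !(integral_weight_rep w w' _ _ ww') => roo.
have mp e : measurable_fun `]a, b[%classic (fun x => (w' x `^ e)%:E).
  apply/measurable_EFinP; apply: measurable_funTS.
  by apply: (@measurableT_comp _ _ _ _ _ _ (@powR R ^~ e)) => //; exact: measurable_powR.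
apply: (@le_lt_trans _ _ (\int[mu]_(x in `]a, b[) (1%:E + (w' x `^ r)%:E))%E).
  apply: ge0_le_integral => //.
  - by move=> x _; rewrite lee_fin powR_ge0.
  - exact: mp.
  - by apply: emeasurable_funD => //; exact: mp.
  - by move=> x _; rewrite -EFinD lee_fin powR_le1D.
rewrite ge0_integralD//; last 2 first.
- by move=> x _; rewrite lee_fin powR_ge0.
- exact: mp.
rewrite integral_cst//= mul1e lebesgue_measure_itv/= lte_fin ab -EFinB.
by rewrite lte_add_pinfty// ltry.
Qed.

Lemma weight_powR (w : R -> R) (e : R) : weight w -> weight (fun x => w x `^ e).
Proof.
move=> [w0 [h mh wh]]; split; first by move=> x; rewrite powR_gt0.
exists (fun x => h x `^ e); last by apply: filterS wh => x wh _; rewrite wh.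
by apply: (@measurableT_comp _ _ _ _ _ _ (@powR R ^~ e)) => //; exact: measurable_powR.
Qed.

End weights.

Section morrey.
Context {R : realType}.
Local Notation mu := (@lebesgue_measure R).

(** Hoelder's inequality for [1 = w * w^-1] on the interval. *)
Lemma integral_weight_lower (w : R -> R) (q W a b : R) : weight w -> 1 < q ->
  0 < W -> a < b ->
  (\int[mu]_(x in `]a, b[) (w x `^ q)%:E < +oo)%E ->
  (\int[mu]_(x in `]a, b[) (w x `^ (- conj_exponent q))%:E <= W%:E)%E ->
  (((b - a) `^ q * W `^ (1 - q))%:E <= \int[mu]_(x in `]a, b[) (w x `^ q)%:E)%E.
Proof.
move=> ww q1 W0 ab Joo JW.
have q0 : 0 < q by exact: lt_trans q1.
have qm1 : 0 < q - 1 by rewrite subr_gt0.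
pose q' := conj_exponent q; have q'0 : 0 < q' by rewrite divr_gt0.
have qq' : q^-1 + q'^-1 = 1 by rewrite /q' /conj_exponent; field; rewrite !gt_eqF.
have [w' [mw' w'0 ww']] := weight_rep w ww.
move: Joo JW; rewrite !(integral_weight_rep w w' _ _ ww') => Joo JW.
set J := (\int[mu]_(x in _) _)%E in Joo *.
have Jfin : J \is a fin_num.
  by rewrite ge0_fin_numE// integral_ge0// => x _; rewrite lee_fin powR_ge0.
have J0 : (0 < J)%E.
  apply: integral_itv_gt0 => // [|x]; last exact: powR_gt0.
  by apply: (@measurableT_comp _ _ _ _ _ _ (@powR R ^~ q)) => //; exact: measurable_powR.
rewrite -(fineK Jfin); set j := fine J.
have j0 : 0 < j by rewrite -lte_fin /j fineK.
pose g (x : R) := w' x `^ (-1).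
have mg : measurable_fun setT g.
  by apply: (@measurableT_comp _ _ _ _ _ _ (@powR R ^~ (-1))) => //; exact: measurable_powR.
have cut (f : R -> R) (r c : R) : 0 < r -> (forall x, 0 < f x) -> 0 <= c ->
    (\int[mu]_(x in `]a, b[) (f x `^ r)%:E <= c%:E)%E ->
    (\int[mu]_x (`|(f \_ `]a, b[) x| `^ r)%:E <= ((c `^ r^-1) `^ r)%:E)%E.
  move=> r0 f0 c0; rewrite -powRrM (mulVf (lt0r_neq0 r0)) (powRr1 c0) => fc.
  apply: le_trans fc; rewrite [leRHS]integral_mkcond le_eqVlt; apply/orP; left.
  apply/eqP; apply: eq_integral => x _; rewrite !patchE; case: ifP => _.
    by rewrite ger0_norm// ltW.
  by rewrite normr0 powR0 ?gt_eqF.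
have mcut (f : R -> R) : measurable_fun setT f -> measurable_fun setT (f \_ `]a, b[).
  move=> mf; apply/(measurable_restrictT _ _).1; first exact: measurable_itv.
  exact: measurable_funTS.
have := hoelder_bound mu q q' (j `^ q^-1) (W `^ q'^-1) (w' \_ `]a, b[) (g \_ `]a, b[)
  q0 q'0 qq' (powR_ge0 _ _) (powR_ge0 _ _) (mcut _ mw') (mcut _ mg).
have -> : (\int[mu]_x `|((w' \_ `]a, b[) x * (g \_ `]a, b[) x)%:E| = (b - a)%:E)%E.
  transitivity (\int[mu]_(x in `]a, b[) (cst 1%:E x))%E.
    rewrite [RHS]integral_mkcond; apply: eq_integral => x _; rewrite !patchE.
    case: ifP => _; last by rewrite mul0r abse0.
    by rewrite /g powR_inv1 ?ltW// divff ?gt_eqF// gee0_abs // lee_fin.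
  by rewrite integral_cst//= mul1e lebesgue_measure_itv/= lte_fin ab -EFinB.
move=> H; have {H} : ((b - a)%:E <= (j `^ q^-1 * W `^ q'^-1)%:E)%E.
  have Jj : (J <= j%:E)%E by rewrite /j fineK.
  have g0 x : 0 < g x by exact: powR_gt0.
  apply: (H (cut w' q j q0 w'0 (ltW j0) Jj)); apply: (cut g q' W q'0 g0 (ltW W0)).
  apply: le_trans JW; rewrite le_eqVlt; apply/orP; left; apply/eqP.
  by apply: eq_integral => x _; rewrite /g -powRrM mulN1r.
rewrite !lee_fin => H.
have ba0 : 0 <= b - a by rewrite subr_ge0 ltW.
apply: (@le_trans _ _ ((j `^ q^-1 * W `^ q'^-1) `^ q * W `^ (1 - q))).
  rewrite ler_wpM2r ?powR_ge0// ge0_ler_powR ?nnegrE ?mulr_ge0 ?powR_ge0//.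
  exact: ltW.
rewrite powRM ?powR_ge0// -!powRrM mulVf ?gt_eqF// powRr1 ?(ltW j0)//.
rewrite -mulrA -powRD; last by rewrite (gt_eqF W0) implybT.
have -> : q'^-1 * q + (1 - q) = 0.
  by rewrite /q' /conj_exponent; field; rewrite !gt_eqF.
by rewrite powRr0 mulr1.
Qed.

Variables (p q sigma delta0 : R) (w : R -> R).
Hypotheses (p1 : 1 < p) (q1 : 1 < q) (d0 : 0 < delta0).
Hypotheses (pq : p < q) (Aw : Aplus p q sigma w).

Let ww : weight w := Aw.1.

Lemma morrey_Phi_fin (lam theta x0 h : R) : 0 <= theta <= q -> 0 < h ->
  exists2 phi : R, 0 < phi & morrey_Phi w lam theta x0 h = phi%:E.
Proof.
move=> /andP[t0 tq] h0; have xh : x0 - h < x0 by rewrite gtrBl.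
have oo := (Aplus_loc_integrable p q sigma w p1 q1 Aw _ _ xh).1.
have oo' := integral_powR_le w _ _ _ _ ww xh t0 tq oo.
have gt0 := integral_weight_gt0 w _ _ theta ww xh.
have fin : (\int[mu]_(x in `](x0 - h)%R, x0[) (w x `^ theta)%:E)%E \is a fin_num.
  by rewrite ge0_fin_numE// ltW.
rewrite /morrey_Phi -(fineK fin) -EFinM; eexists; last by [].
by rewrite mulr_gt0 ?powR_gt0// -lte_fin fineK.
Qed.

(** The lower bound of the integral of [w `^ q] over an interval of length [h] is
    of order [h `^ q], hence [morrey_Phi] is at least of order
    [h `^ (q + mu0 - 1)], and [q + mu0 <= 2] makes this at least of order [h]
    on bounded intervals. *)
Lemma morrey_Phi_lower (mu0 : R) : q + mu0 <= 2 -> exists2 c : R, 0 < c &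
  forall x0 h, 0 <= x0 <= delta0 -> 0 < h <= delta0 ->
    ((c * h)%:E <= morrey_Phi w mu0 q x0 h)%E.
Proof.
move=> qmu.
have dd : - delta0 < delta0 by rewrite (lt_trans _ d0)// oppr_lt0.
have q0 : 0 < q by exact: lt_trans q1.
have p0 : 0 < p by exact: lt_trans p1.
have qm1 : 0 < q - 1 by rewrite subr_gt0.
have pm1 : 0 < p - 1 by rewrite subr_gt0.
have conj_le : conj_exponent q <= conj_exponent p.
  rewrite /conj_exponent ler_pdivrMr// mulrAC ler_pdivlMr//.
  by rewrite !mulrBr !mulr1 [p * q]mulrC lerB// ltW.
have conj0 : 0 <= conj_exponent q by rewrite divr_ge0 ?ltW.
pose I D := (\int[mu]_(x in D) (w x `^ (- conj_exponent q))%:E)%E.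
have wI D : I D = (\int[mu]_(x in D) ((w x `^ (-1)) `^ conj_exponent q)%:E)%E.
  by apply: eq_integral => x _; rewrite -powRrM mulN1r.
have Ioo : (I `](- delta0)%R, delta0[%classic < +oo)%E.
  rewrite wI; apply: (integral_powR_le (fun x => w x `^ (-1)) _ _ _ (conj_exponent p)) => //.
    exact: weight_powR.
  have := (Aplus_loc_integrable p q sigma w p1 q1 Aw _ _ dd).2.
  by under eq_integral do rewrite -mulN1r powRrM.
have I0 : (0 <= I `](- delta0)%R, delta0[%classic)%E.
  by apply: integral_ge0 => x _; rewrite lee_fin powR_ge0.
have Ifin : I `](- delta0)%R, delta0[%classic \is a fin_num by rewrite ge0_fin_numE.
pose W := fine (I `](- delta0)%R, delta0[%classic) + 1.
have W0 : 0 < W by rewrite ltr_wpDl// fine_ge0.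
exists (delta0 `^ (q + mu0 - 2) * W `^ (1 - q)).
  by rewrite mulr_gt0 ?powR_gt0.
move=> x0 h /andP[x00 x0d] /andP[h0 hd].
have xh : x0 - h < x0 by rewrite gtrBl.
have oo := (Aplus_loc_integrable p q sigma w p1 q1 Aw _ _ xh).1.
have IW : (I `](x0 - h)%R, x0[%classic <= W%:E)%E.
  apply: (@le_trans _ _ (I `](- delta0)%R, delta0[%classic)); last first.
    by rewrite /W EFinD fineK// leeDl.
  have [w' [mw' w'0 ww']] := weight_rep w ww.
  rewrite /I !(integral_weight_rep w w' _ _ ww').
  apply: ge0_subset_integral => //=.
  - apply/measurable_EFinP; apply: measurable_funTS.
    by apply: (@measurableT_comp _ _ _ _ _ _ (@powR R ^~ _)) => //; exact: measurable_powR.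
  - by move=> x _; rewrite lee_fin powR_ge0.
  - move=> x; rewrite /= !in_itv/= => /andP[h1 h2].
    by apply/andP; split; [move: h1; lra|exact: lt_le_trans x0d].
have := integral_weight_lower w q W _ _ ww q1 W0 xh oo IW.
have -> : x0 - (x0 - h) = h by ring.
move=> low; rewrite /morrey_Phi.
apply: (@le_trans _ _ ((h `^ (mu0 - 1))%:E * (h `^ q * W `^ (1 - q))%:E)%E); last first.
  by rewrite lee_wpmul2l// lee_fin powR_ge0.
rewrite -EFinM lee_fin.
have -> : h `^ (mu0 - 1) * (h `^ q * W `^ (1 - q)) = h `^ (q + mu0 - 2) * W `^ (1 - q) * h.
  rewrite -[X in _ = _ * X](powRr1 (ltW h0)) [RHS]mulrAC -powRD; last first.
    by rewrite (gt_eqF h0) implybT.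
  rewrite mulrA -powRD; last by rewrite (gt_eqF h0) implybT.
  by congr (_ `^ _ * _); ring.
rewrite ler_wpM2r ?(ltW h0)// ler_wpM2r ?powR_ge0//.
rewrite -[q + mu0 - 2]opprB !powRN lef_pV2 ?posrE ?powR_gt0//.
by rewrite ge0_ler_powR ?nnegrE ?(ltW h0) ?(ltW d0)// subr_ge0.
Qed.

End morrey.

(** * Morrey norms *)

Section morrey_norms.
Context {R : realType}.
Local Notation mu := (@lebesgue_measure R).

Lemma lee_poweR2r (r : R) (x y : \bar R) : 0 <= r -> (0 <= x)%E -> (x <= y)%E ->
  (x `^ r <= y `^ r)%E.
Proof.
move=> r0 x0 xy; apply: gt0_ler_poweR => //; rewrite in_itv/= leey andbT//.
exact: le_trans xy.
Qed.

Lemma morrey_norm_ge0 (d p lam theta : R) (w g : R -> R) : 0 < d ->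
  (0 <= morrey_norm d p lam theta w g)%E.
Proof.
move=> d0; apply: le_trans; last first.
  by apply: ereal_sup_ubound; exists 0, d; split; [rewrite lexx ltW|rewrite d0/=|].
exact: poweR_ge0.
Qed.

(** The norm of the Morrey space dominates the Lebesgue norm on the whole
    interval: take [x0 = 0] and [h = d]. *)
Lemma morrey_norm_Lp (d p lam theta phi M : R) (w g : R -> R) : 0 < d -> 0 < p ->
  0 < phi -> morrey_Phi w lam theta 0 d = phi%:E -> 0 <= M ->
  (morrey_norm d p lam theta w g <= M%:E)%E ->
  (\int[mu]_(y in `]0%R, d[) (`|g y| `^ p)%:E <= ((phi `^ p^-1 * M) `^ p)%:E)%E.
Proof.
move=> d0 p0 phi0 phiE M0 gM.
set I := (\int[mu]_(y in _) _)%E.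
have I0 : (0 <= I)%E by apply: integral_ge0 => x _; rewrite lee_fin powR_ge0.
have : (((phi^-1)%:E * I) `^ p^-1 <= M%:E)%E.
  apply: le_trans gM; apply: ereal_sup_ubound; exists 0, d.
  split; [by rewrite lexx ltW|by rewrite d0/=|].
  by rewrite phiE inver gt_eqF// add0r setIid.
move=> H; have {}H : ((phi^-1)%:E * I <= (M `^ p)%:E)%E.
  have := lee_poweR2r p _ _ (ltW p0) (poweR_ge0 _ _) H.
  rewrite -poweRrM mulVf ?gt_eqF// poweRe1//.
  by rewrite mule_ge0// lee_fin invr_ge0 ltW.
rewrite powRM ?powR_ge0// -powRrM mulVf ?gt_eqF// powRr1 ?(ltW phi0)//.
by rewrite EFinM -lee_pdivrMl.
Qed.

(** The mass of a bounded function on an interval of length [h] is at most of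
    order [h], which the normalizing factor compensates. *)
Lemma morrey_norm_bounded (d0 q lam theta c : R) (w : R -> R) : 0 < q -> 0 < c ->
  (forall x0 h, 0 <= x0 <= d0 -> 0 < h <= d0 ->
    ((c * h)%:E <= morrey_Phi w lam theta x0 h)%E) ->
  exists2 K : R, 0 < K & forall (d S : R) (u : R -> R), d <= d0 -> 0 <= S ->
    measurable_fun setT u -> (forall y, `|u y| <= S) ->
    (morrey_norm d q lam theta w u <= (K * S)%:E)%E.
Proof.
move=> q0 c0 low; exists (c^-1 `^ q^-1); first by rewrite powR_gt0// invr_gt0.
move=> d S u dd0 S0 mu_ uS; apply: ge_ereal_sup => _ [x0 [h [/andP[x00 x0d] /andP[h0 hd] ->]]].
have xh : x0 < x0 + h by rewrite ltrDl.
have Phi_low : ((c * h)%:E <= morrey_Phi w lam theta x0 h)%E.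
  by apply: low; rewrite ?x00 ?h0/= (le_trans _ dd0).
have ch0 : 0 < c * h by rewrite mulr_gt0.
set A := `]x0, (x0 + h)%R[%classic `&` _.
have mA : measurable A by apply: measurableI; exact: measurable_itv.
have IS : (\int[mu]_(y in A) (`|u y| `^ q)%:E <= (S `^ q * h)%:E)%E.
  have mS : measurable_fun setT (fun y => (`|u y| `^ q)%:E).
    apply/measurable_EFinP.
    apply: (@measurableT_comp _ _ _ _ _ _ (@powR R ^~ q)).
      exact: measurable_powR.
    exact: measurableT_comp.
  apply: (@le_trans _ _ (\int[mu]_(y in A) (cst (S `^ q)%:E y))%E).
    apply: ge0_le_integral => //.
    - exact: measurable_funTS.
    - by move=> y _; rewrite lee_fin ge0_ler_powR// ltW.
  rewrite integral_cst// EFinM lee_wpmul2l ?lee_fin ?powR_ge0//.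
  apply: (@le_trans _ _ (mu `]x0, (x0 + h)%R[%classic)).
    by apply: le_measure; rewrite ?inE// => y [].
  by rewrite lebesgue_measure_itv/= lte_fin xh -EFinB lee_fin addrAC subrr add0r.
apply: (@le_trans _ _ (((c^-1 * S `^ q)%:E) `^ q^-1)%E).
  apply: lee_poweR2r; first by rewrite invr_ge0 ltW.
    rewrite mule_ge0// ?inve_ge0.
      by apply: le_trans Phi_low; rewrite lee_fin ltW.
    by apply: integral_ge0 => y _; rewrite lee_fin powR_ge0.
  have -> : (c^-1 * S `^ q)%:E = (((c * h)^-1)%:E * (S `^ q * h)%:E)%E.
    by rewrite -EFinM; congr EFin; field; rewrite !gt_eqF.
  apply: lee_pmul => //.
  - by rewrite inve_ge0; apply: le_trans Phi_low; rewrite lee_fin ltW.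
  - by apply: integral_ge0 => y _; rewrite lee_fin powR_ge0.
  have -> : (((c * h)^-1)%:E = ((c * h)%:E)^-1)%E by rewrite inver gt_eqF.
  by rewrite lee_pV2 ?inE//=; [apply: le_trans Phi_low|]; rewrite lee_fin ltW.
rewrite poweR_EFin powRM ?powR_ge0 ?invr_ge0 ?(ltW c0)// -powRrM mulfV ?gt_eqF//.
by rewrite powRr1.
Qed.

Lemma ge0_lty_EFin (x : \bar R) : (0 <= x)%E -> (x < +oo)%E ->
  exists2 r : R, 0 <= r & x = r%:E.
Proof. by case: x => // r; rewrite lee_fin => r0 _; exists r. Qed.

Lemma powR_ratio_le (e h h' K : R) : 0 <= e -> 0 < h' -> 0 <= h -> h <= K * h' ->
  h `^ e <= K `^ e * h' `^ e.
Proof.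
move=> e0 h'0 h0 hK.
have K0 : 0 <= K by rewrite -(pmulr_lge0 _ h'0) (le_trans h0).
rewrite -powRM ?(ltW h'0)//.
by apply: ge0_ler_powR; rewrite // nnegrE mulr_ge0// ltW.
Qed.

(** The integral of the weight increases with the length of the interval, so that
    only the power of the length has to be compared. *)
Lemma morrey_Phi_le (lam theta x0 h h' K : R) (w : R -> R) : weight w ->
  lam <= 1 -> 0 < h' -> h' <= h -> h <= K * h' ->
  (morrey_Phi w lam theta x0 h' <=
   (K `^ (1 - lam))%:E * morrey_Phi w lam theta x0 h)%E.
Proof.
move=> ww lam1 h'0 h'h hK; have h0 : 0 < h by exact: lt_le_trans h'h.
have [w' [mw' w'0 ww']] := weight_rep w ww.
rewrite /morrey_Phi muleA -EFinM !(integral_weight_rep w w' _ _ ww').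
apply: lee_pmul.
- by rewrite lee_fin powR_ge0.
- by apply: integral_ge0 => y _; rewrite lee_fin powR_ge0.
- have lam0 : 0 <= 1 - lam by rewrite subr_ge0.
  have := powR_ratio_le _ h h' K lam0 h'0 (ltW h0) hK.
  rewrite lee_fin -[lam - 1]opprB !powRN => H.
  by rewrite ler_pdivlMr ?powR_gt0// mulrC ler_pdivrMr ?powR_gt0.
- apply: ge0_subset_integral => //=.
  + apply/measurable_EFinP; apply: measurable_funTS.
    exact: (@measurableT_comp _ _ _ _ _ _ (@powR R ^~ theta) _ w'
              (measurable_powR _) mw').
  + by move=> y _; rewrite lee_fin powR_ge0.
  + move=> y /=; rewrite !in_itv/= => /andP[h1 ->]; rewrite andbT.
    by rewrite (le_lt_trans _ h1)// lerB.
Qed.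

Lemma setI_itv_min (x0 h d : R) : 0 <= x0 ->
  `]x0, x0 + h[%classic `&` `]0, d[%classic =
  `]x0, x0 + Num.min h d[%classic `&` `]0, d[%classic :> set R.
Proof.
move=> x00; apply/seteqP.
split => y /=; rewrite !in_itv/= => -[/andP[h1 h2] /andP[h3 h4]];
  split; apply/andP; split => //.
- by case: (leP h d) => _ //; rewrite (lt_le_trans h4)// lerDr.
- by rewrite (lt_le_trans h2)// lerD2l ge_min lexx.
Qed.

(** Extending a function by zero to a longer interval keeps it in the Morrey
    space: for [h > d] the mass in [(x0, x0 + h)] is the mass in [(x0, x0 + d)],
    and the two normalizing factors are comparable. *)
Lemma morrey_cut_itv (d d0 q lam theta : R) (w v : R -> R) :
  0 < d -> d <= d0 -> 0 < q -> lam <= 1 ->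
  (forall x0 h, 0 < h ->
     exists2 phi : R, 0 < phi & morrey_Phi w lam theta x0 h = phi%:E) ->
  weight w ->
  morrey d q lam theta w v -> morrey d0 q lam theta w (cut_itv d v).
Proof.
move=> dgt0 dd0 q0 lam1 Phi_fin ww [mv nv].
split.
  have [h [mh h0 vh]] := lmeasurable_rep _ _ (measurable_itv _) mv.
  exists h; first exact: measurable_funTS.
  apply: filterS vh => x vh _; rewrite /cut_itv; case: ifPn => [xd|xd].
    exact: vh.
  by rewrite h0//; apply/negP.
have [N N0 vN] := ge0_lty_EFin _ (morrey_norm_ge0 d q lam theta w v dgt0) nv.
have {vN} sup_le x0 h : 0 <= x0 <= d -> 0 < h <= d ->
    (((morrey_Phi w lam theta x0 h)^-1
      * \int[mu]_(y in `]x0, (x0 + h)%R[ `&` `]0%R, d[) (`|v y| `^ q)%:E) `^ q^-1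
     <= N%:E)%E.
  by move=> x0d hd; rewrite -vN; apply: ereal_sup_ubound; exists x0, h.
pose k := (d0 / d) `^ (1 - lam).
have d1 : 1 <= d0 / d by rewrite ler_pdivlMr// mul1r.
have k0 : 0 < k by rewrite powR_gt0// (lt_le_trans _ d1).
apply: (@le_lt_trans _ _ (k `^ q^-1 * N)%:E); last exact: ltry.
apply: ge_ereal_sup => _ [x0 [h [/andP[x00 x0d] /andP[h0 hd] ->]]].
have -> : (\int[mu]_(y in `]x0, (x0 + h)%R[ `&` `]0%R, d0[) (`|cut_itv d v y| `^ q)%:E =
    \int[mu]_(y in `]x0, (x0 + h)%R[ `&` `]0%R, d[) (`|v y| `^ q)%:E)%E.
  rewrite [LHS]integral_mkcond [RHS]integral_mkcond; apply: eq_integral => y _.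
  rewrite !patchE /cut_itv !in_setI !mem_setE.
  have [_|] := boolP (y \in `]x0, (x0 + h)%R[); rewrite ?andbF ?andFb//=.
  have [yd|yd] := boolP (y \in `]0, d[).
    suff -> : y \in `]0, d0[ by [].
    by move: yd; rewrite !in_itv/= => /andP[-> /lt_le_trans->].
  by case: ifP => // _; rewrite normr0 powR0// gt_eqF.
have [xd|dx] := leP x0 d; last first.
  rewrite (_ : _ `&` _ = set0); last first.
    apply/seteqP; split => y //=; rewrite !in_itv/= => -[/andP[h1 _] /andP[_ h2]].
    by have := lt_trans (lt_trans dx h1) h2; rewrite ltxx.
  rewrite integral_set0 mule0 poweR_EFin powR0 ?gt_eqF ?invr_gt0//.
  by rewrite lee_fin mulr_ge0 ?powR_ge0.
rewrite (setI_itv_min x0 h d x00); set h' := Num.min h d.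
have h'0 : 0 < h' by rewrite lt_min h0.
have h'd : h' <= d by rewrite ge_min lexx orbT.
have h'h : h' <= h by rewrite ge_min lexx.
have hK : h <= d0 / d * h'.
  rewrite /h'; case: (leP h d) => _; first by rewrite ler_peMl// ltW.
  by rewrite divfK ?gt_eqF.
have := sup_le x0 h'; rewrite x00 xd h'0 h'd => /(_ isT isT).
have := morrey_Phi_le lam theta x0 h h' _ w ww lam1 h'0 h'h hK.
have [phi phi0 ->] := Phi_fin x0 h h0; have [phi' phi'0 ->] := Phi_fin x0 h' h'0.
rewrite -EFinM lee_fin -/k !inver (gt_eqF phi0) (gt_eqF phi'0).
set I := (\int[mu]_(y in _) _)%E => phik IN.
have I0 : (0 <= I)%E by apply: integral_ge0 => y _; rewrite lee_fin powR_ge0.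
apply: (@le_trans _ _ ((k%:E * ((phi'^-1)%:E * I)) `^ q^-1)%E).
  apply: lee_poweR2r; first by rewrite invr_ge0 ltW.
    by rewrite mule_ge0// lee_fin invr_ge0 ltW.
  rewrite muleA -EFinM lee_wpmul2r// lee_fin.
  by rewrite ler_pdivlMr// mulrC ler_pdivrMr.
rewrite poweRM ?lee_fin ?(ltW k0)//; last first.
  by rewrite mule_ge0// lee_fin invr_ge0 ltW.
by rewrite poweR_EFin EFinM lee_wpmul2l// lee_fin powR_ge0.
Qed.

End morrey_norms.

(** * The integral equation in Morrey spaces *)

Section nemytskii_volterra.
Context {R : realType}.
Local Notation mu := (@lebesgue_measure R).

Lemma le0_of_halving (x S : R) :
  (forall n, x <= S / 2 ^+ n) -> x <= 0.
Proof.
move=> xS; apply/ler_addgt0Pl => e e0; rewrite addr0.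
have [S0|S0] := leP S 0.
  by apply: le_trans (xS 0%N) _; rewrite expr0 divr1 (le_trans S0)// ltW.
have [n Sn] : exists n : nat, S / e <= n%:R.
  by exists (Num.truncn (S / e)).+1; rewrite ltW// truncnS_gt.
apply: le_trans (xS n) _; rewrite ler_pdivrMr ?exprn_gt0// mulrC -ler_pdivrMr//.
apply: le_trans Sn _; rewrite -natrX ler_nat ltnW//.
exact: ltn_expl.
Qed.

Lemma lmeasurableB (D : set R) (g h : R -> R) :
  lmeasurable D g -> lmeasurable D h -> lmeasurable D (g \- h).
Proof.
move=> [g' mg gg'] [h' mh hh']; exists (g' \- h'); first exact: measurable_funB.
by apply: filterS2 gg' hh' => x gg' hh' Dx; rewrite /= gg'// hh'.
Qed.

Lemma lmeasurable_fun (D : set R) (u : R -> R) :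
  measurable_fun setT u -> lmeasurable D u.
Proof. by move=> mu_; exists u; [exact: measurable_funTS|exact/aeW]. Qed.

Lemma Lp_integrable (p d : R) (h : R -> R) : 1 <= p -> 0 < d ->
  measurable_fun setT h -> (forall x, ~ `]0, d[%classic x -> h x = 0) ->
  (\int[mu]_x (`|h x| `^ p)%:E < +oo)%E -> mu.-integrable setT (EFin \o h).
Proof.
move=> p1 d0 mh h0 hp; apply/integrableP; split; first exact/measurable_EFinP.
have mhp : measurable_fun setT (fun x => (`|h x| `^ p)%:E).
  apply/measurable_EFinP.
  apply: (@measurableT_comp _ _ _ _ _ _ (@powR R ^~ p)).
    exact: measurable_powR.
  exact: measurableT_comp.
have mI : measurable_fun setT (fun x => (\1_(`]0, d[%classic : set R) x)%:E : \bar R).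
  by apply/measurable_EFinP; exact: measurable_indic.
apply: (@le_lt_trans _ _
  (\int[mu]_x ((\1_(`]0, d[%classic : set R) x)%:E + (`|h x| `^ p)%:E))%E).
  apply: ge0_le_integral => //.
  - by apply: measurableT_comp => //; exact/measurable_EFinP.
  - exact: emeasurable_funD.
  move=> x _; rewrite -EFinD lee_fin indicE.
  have [xd|xd] := pselect (`]0, d[%classic x); last first.
    by rewrite h0// normr0 addr_ge0 ?powR_ge0.
  rewrite mem_set//; have [->|hx] := eqVneq (h x) 0.
    by rewrite normr0 addr_ge0 ?powR_ge0.
  rewrite -[leLHS]powRr1//; apply: powR_le1D => //.
  by rewrite normr_gt0.
rewrite ge0_integralD//.
rewrite integral_indic//= setIT lebesgue_measure_itv/= lte_fin d0 -EFinB.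
by rewrite lte_add_pinfty// ltry.
Qed.

Lemma bounded_itv_integrable (d : R) (S : R) (u : R -> R) : 0 < d ->
  measurable_fun setT u -> (forall t, `|u t| <= S) ->
  (forall t, t \notin `]0, d[ -> u t = 0) -> mu.-integrable setT (EFin \o u).
Proof.
move=> d0 mu_ uS u0; have S0 : 0 <= S := le_trans (normr_ge0 _) (uS 0).
apply/integrableP; split; first exact/measurable_EFinP.
apply: (@le_lt_trans _ _ (\int[mu]_(x in `]0%R, d[) (cst S%:E x))%E); last first.
  by rewrite integral_cst//= lebesgue_measure_itv/= lte_fin d0 -EFinB -EFinM ltry.
rewrite [leRHS]integral_mkcond; apply: ge0_le_integral => //.
- by apply: measurableT_comp => //; exact/measurable_EFinP.
- apply/(measurable_restrictT _ _).1; first exact: measurable_itv.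
  exact: measurable_cst.
move=> x _; rewrite patchE mem_setE; case: ifPn => [_|xd]; first by rewrite lee_fin.
by rewrite /= u0// normr0.
Qed.

Lemma lmeasurable_Lp_rep (p d : R) (g : R -> R) (A : R) : 1 <= p -> 0 < d ->
  lmeasurable `]0, d[%classic g ->
  (\int[mu]_(s in `]0%R, d[) (`|g s| `^ p)%:E <= A%:E)%E ->
  exists h : R -> R, [/\ ae_eq mu `]0, d[%classic g h,
    measurable_fun setT h & mu.-integrable setT (EFin \o h)].
Proof.
move=> p1 d0 mg gA; have [h [mh h0 gh]] := lmeasurable_rep _ _ (measurable_itv _) mg.
exists h; split => //; apply: (Lp_integrable p d) => //.
have p0 : p != 0 by rewrite gt_eqF// (lt_le_trans _ p1).
by rewrite (integral_Lp_rep p d g h p0 h0 gh); apply: le_lt_trans gA _; exact: ltry.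
Qed.

Variables (sigma p q beta mu0 alpha delta0 : R) (w : R -> R) (f : R -> R -> R).
Local Notation X d := (morrey d q mu0 q w).
Local Notation Y d := (morrey d p beta p w).
Local Notation normX := (morrey_norm delta0 q mu0 q w).
Local Notation normY := (morrey_norm delta0 p beta p w).
Local Notation F := (nemytskii f).
Hypotheses (p1 : 1 < p) (q1 : 1 < q) (pq : p < q) (mu1 : mu0 < 1).
Hypotheses (Aw : Aplus p q sigma w) (qmu : q + mu0 <= 2) (d00 : 0 < delta0).
Hypotheses (XY : forall u, X delta0 u -> Y delta0 (F u)).
Hypotheses (bF : bounded_operator (X delta0) normX normY F).
Hypotheses (cF : continuous_operator (X delta0) normX normY F).
Hypotheses (pa : p^-1 < alpha) (a1 : alpha < 1).

Let p0 : 0 < p. Proof. exact: lt_trans p1. Qed.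
Let q0 : 0 < q. Proof. exact: lt_trans q1. Qed.
Let alpha0 : 0 < alpha. Proof. by apply: lt_trans pa; rewrite invr_gt0. Qed.

(** The normalizing factor of [X] is at least of order [h] by [q + mu0 <= 2]. As
    [K] serves for all intervals, a function supported in a short one can be
    measured in the spaces over [(0, delta0)], in which [F] is controlled. *)
Lemma bounded_in_X : exists2 K : R, 0 < K & forall (d S : R) (u : R -> R),
  0 < d -> d <= delta0 -> 0 <= S -> measurable_fun setT u ->
  (forall y, `|u y| <= S) ->
  X d u /\ (morrey_norm d q mu0 q w u <= (K * S)%:E)%E.
Proof.
have [c c0 low] := morrey_Phi_lower p q sigma delta0 w p1 q1 d00 pq Aw mu0 qmu.
have [K K0 HK] := morrey_norm_bounded delta0 q mu0 q c w q0 c0 low.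
exists K => // d S u d0 dd0 S0 mu_ uS.
have uK := HK d S u dd0 S0 mu_ uS.
split=> //; split; first exact: lmeasurable_fun.
by apply: le_lt_trans uK _; exact: ltry.
Qed.

(** The space [Y] is contained in [L^p], and [p^-1 < alpha]. The second estimate,
    in which the two functions need only be close in [Y], serves both the
    continuity of the integral operator and its contraction property. *)
Lemma RL_morrey_holder : exists C k : R, [/\ 0 <= C, 0 < k,
  (forall g (M : R), 0 <= M -> lmeasurable `]0, delta0[%classic g ->
    (normY g <= M%:E)%E -> forall s t, 0 <= s -> s <= t -> t <= delta0 ->
    `|RL_integral alpha g t - RL_integral alpha g s| <= C * M * (t - s) `^ k) &
  (forall g1 g2 (M : R), 0 <= M ->
    lmeasurable `]0, delta0[%classic g1 -> lmeasurable `]0, delta0[%classic g2 ->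
    (normY g1 < +oo)%E -> (normY g2 < +oo)%E -> (normY (g1 \- g2)%R <= M%:E)%E ->
    forall t, 0 <= t -> t <= delta0 ->
    `|RL_integral alpha g1 t - RL_integral alpha g2 t| <= C * M * t `^ k)].
Proof.
have [C [k [C0 k0 HC]]] := RL_holder p alpha p1 pa (ltW a1).
have pq01 : 0 <= p <= q by rewrite !ltW.
have [phi phi0 phiE] := morrey_Phi_fin p q sigma w p1 q1 Aw beta p 0 delta0 pq01 d00.
have Lp g M (M0 : 0 <= M) (gM : (normY g <= M%:E)%E) :=
  morrey_norm_Lp delta0 p beta p phi M w g d00 p0 phi0 phiE M0 gM.
have holder : forall g (M : R), 0 <= M -> lmeasurable `]0, delta0[%classic g ->
    (normY g <= M%:E)%E -> forall s t, 0 <= s -> s <= t -> t <= delta0 ->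
    `|RL_integral alpha g t - RL_integral alpha g s| <=
      C * phi `^ p^-1 * M * (t - s) `^ k.
  move=> g M M0 mg gM s t s0 st td; rewrite -(mulrA C).
  by apply: (HC delta0 g) => //; [rewrite mulr_ge0 ?powR_ge0|exact: Lp].
exists (C * phi `^ p^-1), k; split => //; first by rewrite mulr_ge0 ?powR_ge0.
move=> g1 g2 M M0 mg1 mg2 g1oo g2oo g12 t t0 td.
have n1 := morrey_norm_ge0 delta0 p beta p w g1 d00.
have n2 := morrey_norm_ge0 delta0 p beta p w g2 d00.
have [r1 r10 g1r] := ge0_lty_EFin _ n1 g1oo.
have [r2 r20 g2r] := ge0_lty_EFin _ n2 g2oo.
have A0 : 0 <= r1 + r2 := addr_ge0 r10 r20.
have g1A : (normY g1 <= (r1 + r2)%:E)%E by rewrite g1r lee_fin lerDl.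
have g2A : (normY g2 <= (r1 + r2)%:E)%E by rewrite g2r lee_fin lerDr.
have B0 : 0 <= phi `^ p^-1 * (r1 + r2) by apply: mulr_ge0 => //; exact: powR_ge0.
have RLB := RL_integralB p alpha delta0 t g1 g2 _ p1 pa (ltW a1) B0 mg1 mg2
  (Lp g1 _ A0 g1A) (Lp g2 _ A0 g2A) t0 td.
have := holder (g1 \- g2) M M0 (lmeasurableB _ _ _ mg1 mg2) g12 0 t (lexx _) t0 td.
by rewrite RLB (RL_integral_le0 alpha 0)// !subr0.
Qed.

Lemma morrey_integrable_rep (d e lam theta : R) (g : R -> R) : 0 < d -> 1 <= e ->
  0 <= theta <= q -> morrey d e lam theta w g ->
  exists h : R -> R, [/\ ae_eq mu `]0, d[%classic g h,
    measurable_fun setT h & mu.-integrable setT (EFin \o h)].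
Proof.
move=> d0 e1 tq [mg goo].
have e0 : 0 < e by exact: lt_le_trans e1.
have [phi phi0 phiE] := morrey_Phi_fin p q sigma w p1 q1 Aw lam theta 0 d tq d0.
have [M M0 gM] := ge0_lty_EFin _ (morrey_norm_ge0 d e lam theta w g d0) goo.
have nM : (morrey_norm d e lam theta w g <= M%:E)%E by rewrite gM.
exact: (lmeasurable_Lp_rep e d g _ e1 d0 mg
  (morrey_norm_Lp d e lam theta phi M w g d0 e0 phi0 phiE M0 nM)).
Qed.

(** The operator [u |-> RL_integral alpha (F u)] maps the unit ball of the uniform
    norm, on which [F] is bounded, to functions that are uniformly Hoelder
    continuous and vanish at zero; on a short interval these have values in the
    unit ball again. *)
Lemma unit_ball_fixed_point : exists2 delta1 : R, 0 < delta1 <= delta0 &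
  forall d, 0 < d <= delta1 -> exists2 u, unit_ball_itv d u &
    forall t, t \in `]0, d[ -> u t = RL_integral alpha (F u) t.
Proof.
have [K K0 HK] := bounded_in_X.
have [C [k [C0 k0 HC HCB]]] := RL_morrey_holder.
have [M0 HM0] := bF K.
pose M := Num.max M0 0.
have M_ge0 : 0 <= M by rewrite le_max lexx orbT.
have [r r0 Hr] := powR_small (C * M) k 1 (mulr_ge0 C0 M_ge0) k0 ltr01.
exists (Num.min r delta0) => [|d /andP[d0]]; first by rewrite lt_min r0 d00 ge_min lexx orbT.
rewrite le_min => /andP[dr dd0].
have XB (u : R -> R) S : 0 <= S -> measurable_fun setT u -> (forall t, `|u t| <= S) ->
    X delta0 u /\ (normX u <= (K * S)%:E)%E.
  by move=> S0 mu_ uS; exact: HK.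
have XU u : unit_ball_itv d u -> X delta0 u /\ (normX u <= K%:E)%E.
  move=> [mu_ u1 _]; have := XB u 1 ler01 mu_ u1.
  by rewrite mulr1.
have YM u : unit_ball_itv d u -> (normY (F u) <= M%:E)%E.
  move=> /XU[Xu uK]; apply: le_trans (HM0 u Xu uK) _.
  by rewrite lee_fin le_max lexx.
have YU u : unit_ball_itv d u -> Y delta0 (F u) by move=> /XU[/XY].
have [u uB ufix] : exists2 u, unit_ball_itv d u &
    forall t, 0 < t -> t < d -> u t = RL_integral alpha (F u) t.
  apply: (volterra_fixed_point d (C * M) k d0 (mulr_ge0 C0 M_ge0) k0 _
    (fun u => RL_integral alpha (F u))).
  - by apply: Hr => //; exact: ltW.
  - move=> u uB s t s0 st td; apply: HC => //; last exact: le_trans dd0.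
      by have [] := YU u uB.
    exact: YM.
  - by move=> u t t0; exact: RL_integral_le0.
  - move=> u v t uv; apply: (RL_integral_congr alpha t) => // s.
    by rewrite in_itv/= => /andP[s0 st]; rewrite /nemytskii uv.
  - move=> u uB e e0.
    have B0 : 0 < C * delta0 `^ k + 1 by rewrite ltr_wpDl ?mulr_ge0 ?powR_ge0.
    (* the tolerance in [Y] that the fractional integral turns into [e] *)
    pose eps := e / (C * delta0 `^ k + 1).
    have eps0 : 0 < eps by rewrite divr_gt0.
    have [dc dc0 Hdc] := cF u (XU u uB).1 eps eps0.
    exists (dc / (2 * K)) => [|v vB uv t t0 td]; first by rewrite divr_gt0 ?mulr_gt0.
    have [mv _ _] := vB; have [mu_ _ _] := uB.
    have rr0 : 0 <= dc / (2 * K) by rewrite ltW// divr_gt0 ?mulr_gt0.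
    have [_ vuK] := XB (v \- u) _ rr0 (measurable_funB mv mu_) uv.
    have vu_dc : (normX (v \- u)%R < dc%:E)%E.
      apply: le_lt_trans vuK _; rewrite lte_fin.
      have -> : K * (dc / (2 * K)) = dc / 2 by field; rewrite gt_eqF.
      by rewrite ltr_pdivrMr// ltr_pMr// ltr1n.
    have FvFu := Hdc v (XU v vB).1 vu_dc.
    have [mFv Fvoo] := YU v vB; have [mFu Fuoo] := YU u uB.
    have td0 : t <= delta0 by exact: le_trans dd0.
    have := HCB (F v) (F u) eps (ltW eps0) mFv mFu Fvoo Fuoo (ltW FvFu) t t0 td0.
    move=> /le_trans; apply.
    apply: (@le_trans _ _ (C * eps * delta0 `^ k)).
      apply: ler_wpM2l; first by rewrite mulr_ge0// ltW.
      by rewrite ge0_ler_powR ?nnegrE ?(ltW k0) ?(ltW d00).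
    rewrite /eps mulrA mulrAC ler_pdivrMr// [C * e]mulrC -mulrA.
    by rewrite ler_wpM2l ?(ltW e0)// lerDl.
exists u => // t; rewrite in_itv/= => /andP[t0 td]; exact: ufix.
Qed.

Lemma bounded_fixed_solution (d S : R) (u : R -> R) : 0 < d <= delta0 -> 0 <= S ->
  measurable_fun setT u -> (forall t, `|u t| <= S) ->
  (forall t, t \in `]0, d[ -> u t = RL_integral alpha (F u) t) ->
  X d u /\ cauchy_solution alpha d f u.
Proof.
move=> /andP[d0 dd0] S0 mu_ uS ufix.
have [K K0 HK] := bounded_in_X.
split; first exact: (HK d S u d0 dd0 S0 mu_ uS).1.
have YFu := XY u (HK delta0 S u d00 (lexx _) S0 mu_ uS).1.
have pq01 : 0 <= p <= q by rewrite !ltW.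
have [h [Fuh mh ih]] := morrey_integrable_rep delta0 p beta p _ d00 (ltW p1) pq01 YFu.
apply: (fixed_cauchy_solution alpha d f alpha0 a1 d0 u h) => //.
  apply: filterS Fuh => t Fuh; rewrite /= in_itv/= => /andP[t0 td].
  by apply: Fuh; rewrite /= in_itv/= t0 (lt_le_trans td).
move=> t td; rewrite ufix//; apply: (RL_integral_congr_ae alpha delta0) => //.
by move: td; rewrite in_itv/= => /andP[_ td]; rewrite (le_trans (ltW td)).
Qed.

(** Every solution in [X] is bounded up to a null set: its image under [F] belongs
    to [Y], whose fractional integrals are Hoelder continuous. This reduces
    uniqueness in [X] to uniqueness among bounded solutions of the integral
    equation. *)
Lemma solution_bounded_fixed (d : R) (v : R -> R) : 0 < d <= delta0 ->
  X d v -> cauchy_solution alpha d f v ->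
  exists S (u : R -> R), [/\ 0 <= S, measurable_fun setT u, forall t, `|u t| <= S,
    forall t, t \notin `]0, d[ -> u t = 0 &
    ae_eq mu `]0, d[%classic v u /\
    forall t, t \in `]0, d[ -> u t = RL_integral alpha (F u) t].
Proof.
move=> /andP[d0 dd0] Xv v_sol.
have pq01 : 0 <= p <= q by rewrite !ltW.
have qq01 : 0 <= q <= q by rewrite lexx ltW.
have Xcv : X delta0 (cut_itv d v).
  apply: morrey_cut_itv => //; first exact: ltW.
  - by move=> x0 h h0; exact: (morrey_Phi_fin p q sigma w p1 q1 Aw).
  - exact: Aw.1.
have Yv := XY _ Xcv.
have [C [k [C0 k0 HC _]]] := RL_morrey_holder.
have [mFv Fvoo] := Yv.
have [M M0 FvM] := ge0_lty_EFin _ (morrey_norm_ge0 delta0 p beta p w _ d00) Fvoo.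
have nM : (normY (F (cut_itv d v)) <= M%:E)%E by rewrite FvM.
pose L := C * M.
have L0 : 0 <= L by rewrite mulr_ge0.
pose z := RL_integral alpha (F (cut_itv d v)).
have hz : holder_itv d L k z.
  move=> s t s0 st td; apply: (HC _ M M0 mFv nM) => //; first exact: ltW.
  by rewrite (le_trans (ltW td)).
pose u := cut_itv d z; pose S := L * d `^ k.
have S0 : 0 <= S by rewrite mulr_ge0 ?powR_ge0.
have mu_ : measurable_fun setT u := holder_itv_measurable d L k L0 k0 z hz.
have uS t : `|u t| <= S.
  rewrite /u /cut_itv; case: ifPn => [|_]; last by rewrite normr0.
  rewrite in_itv/= => /andP[t0 td]; have td0 : t <= delta0 by rewrite (le_trans (ltW td)).
  have := HC _ M M0 mFv nM 0 t (lexx _) (ltW t0) td0.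
  rewrite (RL_integral_le0 alpha 0)// !subr0 => /le_trans; apply.
  by rewrite ler_wpM2l// ge0_ler_powR ?nnegrE ?(ltW k0) ?(ltW t0) ?(ltW d0) ?(ltW td).
have u0 t : t \notin `]0, d[ -> u t = 0 by rewrite /u /cut_itv => /negbTE ->.
have [h [Fh mh ih]] := morrey_integrable_rep delta0 p beta p _ d00 (ltW p1) pq01 Yv.
have [g [vg mg ig]] := morrey_integrable_rep d q mu0 q _ d0 (ltW q1) qq01 Xv.
have iu : mu.-integrable setT (EFin \o u) := bounded_itv_integrable d S u d0 mu_ uS u0.
have Fvh : ae_eq mu `]0, d[%classic (F v) h.
  apply: filterS Fh => t Fh td; rewrite -Fh; first by rewrite /nemytskii cut_itvE.
  move: td; rewrite /= !in_itv/= => /andP[-> td]; exact: lt_le_trans dd0.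
have uh t : t \in `]0, d[ -> u t = RL_integral alpha h t.
  move=> td; rewrite /u cut_itvE//; apply: (RL_integral_congr_ae alpha delta0) => //.
  by move: td; rewrite in_itv/= => /andP[_ td]; rewrite (le_trans (ltW td)).
have vu : ae_eq mu `]0, d[%classic v u.
  exact: (cauchy_solution_fixed alpha d f alpha0 a1 v g h u).
exists S, u; split => //; split => // t td.
rewrite /u cut_itvE//; apply: (RL_integral_congr_ae alpha d).
  by move: td; rewrite in_itv/= => /andP[_ /ltW].
apply: filterS vu => s vu sd; rewrite /nemytskii cut_itvE//.
by rewrite -/(cut_itv d z) -/u vu.
Qed.

(** On a short interval the integral operator halves uniform distances. *)
Lemma bounded_fixed_unique (CF : R) : 0 < CF ->
  lipschitz_operator (X delta0) normX normY F CF ->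
  exists2 delta2 : R, 0 < delta2 <= delta0 & forall d, 0 < d <= delta2 ->
    forall (S : R) (u v : R -> R), 0 <= S ->
    measurable_fun setT u -> measurable_fun setT v ->
    (forall t, `|u t| <= S) -> (forall t, `|v t| <= S) ->
    (forall t, t \notin `]0, d[ -> u t = 0) ->
    (forall t, t \notin `]0, d[ -> v t = 0) ->
    (forall t, t \in `]0, d[ -> u t = RL_integral alpha (F u) t) ->
    (forall t, t \in `]0, d[ -> v t = RL_integral alpha (F v) t) ->
    forall t, u t = v t.
Proof.
move=> CF0 lipF; have [K K0 HK] := bounded_in_X.
have [C [k [C0 k0 _ HCB]]] := RL_morrey_holder.
have B0 : 0 <= C * (CF * K) by rewrite mulr_ge0// mulr_ge0// ltW.
have half0 : 0 < 2^-1 :> R by rewrite invr_gt0.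
have [r r0 Hr] := powR_small _ k _ B0 k0 half0.
exists (Num.min r delta0) => [|d /andP[d0]]; first by rewrite lt_min r0 d00 ge_min lexx orbT.
rewrite le_min => /andP[dr dd0] S u v S0 mu_ mv uS vS u0 v0 ufix vfix.
have Xu := (HK delta0 S u d00 (lexx _) S0 mu_ uS).1.
have Xv := (HK delta0 S v d00 (lexx _) S0 mv vS).1.
have [mFu Fuoo] := XY u Xu; have [mFv Fvoo] := XY v Xv.
have half E : 0 <= E -> (forall t, `|u t - v t| <= E) ->
    forall t, `|u t - v t| <= E / 2.
  move=> E0 uvE t; have [td|td] := boolP (t \in `]0, d[); last first.
    by rewrite u0// v0// subrr normr0 divr_ge0.
  rewrite ufix// vfix//; move: td; rewrite in_itv/= => /andP[t0 td].
  have [_ uvK] := HK delta0 E (u \- v) d00 (lexx _) E0 (measurable_funB mu_ mv) uvE.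
  have FuFv : (normY (F u \- F v)%R <= (CF * K * E)%:E)%E.
    apply: le_trans (lipF u v Xu Xv) _.
    by rewrite -mulrA EFinM lee_wpmul2l// lee_fin ltW.
  have td0 : t <= delta0 by rewrite (le_trans (ltW td)).
  have CKE : 0 <= CF * K * E by rewrite mulr_ge0// mulr_ge0// ltW.
  have := HCB _ _ _ CKE mFu mFv Fuoo Fvoo FuFv t (ltW t0) td0.
  move=> /le_trans; apply.
  rewrite mulrA mulrAC [leRHS]mulrC ler_wpM2r//.
  by apply: Hr; rewrite ?(ltW t0)// (le_trans (ltW td)).
have small n t : `|u t - v t| <= (2 * S) / 2 ^+ n.
  elim: n t => [|n IH] t.
    rewrite expr0 divr1 mulr_natl mulr2n.
    by rewrite (le_trans (ler_normB _ _))// lerD.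
  rewrite exprSr invfM mulrA.
  apply: half; last exact: IH.
  by apply: divr_ge0; [apply: mulr_ge0|apply: exprn_ge0].
move=> t; apply/eqP; rewrite -subr_eq0 -normr_le0.
exact: (le0_of_halving _ _ (small ^~ t)).
Qed.

End nemytskii_volterra.

(** * Existence and uniqueness of solutions *)

Theorem theorem5p3 (R : realType) (sigma p q beta mu alpha delta0 : R)
    (w : R -> R) (f : R -> R -> R)
    (X := fun delta : R => morrey delta q mu q w)
    (Y := fun delta : R => morrey delta p beta p w)
    (normX := morrey_norm delta0 q mu q w)
    (normY := morrey_norm delta0 p beta p w)
    (F := nemytskii f) :
  0 < sigma -> sigma < 1 -> 1 < p -> 1 < q ->
  0 <= beta -> beta < 1 -> 0 <= mu -> mu < 1 ->
  p^-1 - q^-1 = sigma ->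
  Aplus p q sigma w ->
  q + mu <= 2 ->
  0 < delta0 ->
  (forall u, X delta0 u -> Y delta0 (F u)) ->
  bounded_operator (X delta0) normX normY F ->
  continuous_operator (X delta0) normX normY F ->
  2^-1 * (1 + p^-1) < alpha -> alpha < 1 ->
  (exists2 delta1 : R, 0 < delta1 <= delta0 &
     forall delta : R, 0 < delta <= delta1 ->
       exists2 u, X delta u & cauchy_solution alpha delta f u)
  /\
  ((exists2 CF : R, 0 < CF &
      lipschitz_operator (X delta0) normX normY F CF) ->
   exists2 delta2 : R, 0 < delta2 <= delta0 &
     forall delta : R, 0 < delta <= delta2 ->
       exists u, [/\ X delta u, cauchy_solution alpha delta f u &
         forall v, X delta v -> cauchy_solution alpha delta f v ->
           ae_eq leb `]0, delta[%classic v u]).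
Proof.
move=> s0 s1 p1 q1 b0 b1 mu0 mu1 pqs Aw qmu d00 XY bF cF pa a1.
have p0 : 0 < p by exact: lt_trans p1.
have q0 : 0 < q by exact: lt_trans q1.
have pV1 : p^-1 < 1 by rewrite invf_lt1.
have pq : p < q by rewrite -ltf_pV2 ?posrE//; move: pqs s0; lra.
have {}pa : p^-1 < alpha by move: pa pV1; lra.
have [d1 /andP[d10 d1d0] Hex] :=
  unit_ball_fixed_point sigma p q beta mu alpha delta0 w f p1 q1 pq Aw qmu d00 XY bF cF pa a1.
have sol := bounded_fixed_solution sigma p q beta mu alpha delta0 w f
  p1 q1 pq Aw qmu d00 XY pa a1.
have ex d : 0 < d <= d1 -> exists u, [/\ unit_ball_itv d u,
    forall t, t \in `]0, d[ -> u t = RL_integral alpha (F u) t,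
    X d u & cauchy_solution alpha d f u].
  move=> dd1; have [u uB ufix] := Hex d dd1; exists u.
  have [mu_ u1 u0] := uB; move: dd1 => /andP[dgt0 dd1].
  have [|Xu su] := sol d 1 u _ ler01 mu_ u1 ufix; last by split.
  by rewrite dgt0 (le_trans dd1).
split.
  exists d1 => [|d /ex[u [_ _ Xu su]]]; first by rewrite d10.
  by exists u.
move=> [CF CF0 lipF].
have [d2 /andP[d20 d2d0] Huniq] := bounded_fixed_unique sigma p q beta mu alpha delta0 w f
  p1 q1 pq Aw qmu d00 XY pa a1 CF CF0 lipF.
exists (Num.min d1 d2) => [|d /andP[dgt0]].
  by rewrite lt_min d10 d20 ge_min d1d0.
rewrite le_min => /andP[dd1 dd2].
have [u [[mu_ u1 u0] ufix Xu su]] : exists u, [/\ unit_ball_itv d u,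
    forall t, t \in `]0, d[ -> u t = RL_integral alpha (F u) t,
    X d u & cauchy_solution alpha d f u] by apply: ex; rewrite dgt0.
exists u; split; [exact: Xu|exact: su|move=> v Xv sv].
have dd0 : 0 < d <= delta0 by rewrite dgt0 (le_trans dd1).
have [S [v' [S0 mv' v'S v'0 [vv' v'fix]]]] := solution_bounded_fixed sigma p q beta mu
  alpha delta0 w f p1 q1 pq mu1 Aw d00 XY pa a1 d v dd0 Xv sv.
have dd2' : 0 < d <= d2 by rewrite dgt0.
have S1_0 : 0 <= Num.max 1 S by rewrite le_max ler01.
have uS t : `|u t| <= Num.max 1 S by rewrite le_max u1.
have vS t : `|v' t| <= Num.max 1 S by rewrite le_max v'S orbT.
have uv' := Huniq d dd2' _ u v' S1_0 mu_ mv' uS vS u0 v'0 ufix v'fix.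
by apply: filterS vv' => t vv' td; rewrite vv'// uv'.
Qed.
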